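(* Let $m\ge n+1\ge3$. Let $F:\mathbb{B}^n\to D^{IV}_m$ be a holomorphic isometry which is a rational map and satisfies $F(0)=0$. Then $\deg(F)\le2$; more precisely, either $F$ is a (homogeneous) linear map or $\deg(F)=2$.
   Context: $\mathbb{B}^n=\{z\in\mathbb{C}^n:|z|^2<1\}$; $D^{IV}_m=\{Z\in\mathbb{C}^m: Z\overline{Z}^t<2,\ 1-Z\overline{Z}^t+\tfrac14|ZZ^t|^2>0\}$. Bergman metric $\omega_\Omega=\sqrt{-1}\partial\bar\partial\log K_\Omega$ with $K_{\mathbb{B}^n}=c(1-|z|^2)^{-(n+1)}$, $K_{D^{IV}_m}=c'(1-Z\overline{Z}^t+\tfrac14|ZZ^t|^2)^{-m}$; a holomorphic $F$ is a holomorphic isometry if $F^*\omega_{D^{IV}_m}=\lambda\omega_{\mathbb{B}^n}$ for a constant $\lambda>0$. For a rational map $F=(P_1,\dots,P_m)/R$ written in lowest terms with $P_j,R$ polynomials, $\deg(F)=\max\{\deg P_1,\dots,\deg P_m,\deg R\}$. *)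

(* Defs.v *)
From Stdlib Require Import Reals Lra List.
Import ListNotations.
Open Scope R_scope.

Definition C : Type := (R * R)%type.
Definition C0 : C := (0, 0).
Definition C1 : C := (1, 0).
Definition Ci : C := (0, 1).
Definition RtoC (r : R) : C := (r, 0).
Definition Cadd (a b : C) : C := (fst a + fst b, snd a + snd b).
Definition Cmul (a b : C) : C :=
  (fst a * fst b - snd a * snd b, fst a * snd b + snd a * fst b).
Definition Cnorm2 (a : C) : R := fst a * fst a + snd a * snd a.
Definition Cinv (a : C) : C := (fst a / Cnorm2 a, - snd a / Cnorm2 a).
Definition Cdiv (a b : C) : C := Cmul a (Cinv b).
Fixpoint Cpow (a : C) (k : nat) : C :=
  match k with O => C1 | S k' => Cmul a (Cpow a k') end.

Definition Rsum (n : nat) (f : nat -> R) : R :=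
  fold_right (fun i acc => f i + acc) 0 (seq 0 n).
Definition Csum (n : nat) (f : nat -> C) : C :=
  fold_right (fun i acc => Cadd (f i) acc) C0 (seq 0 n).
Definition Cprod (n : nat) (f : nat -> C) : C :=
  fold_right (fun i acc => Cmul (f i) acc) C1 (seq 0 n).
Definition nsum (n : nat) (f : nat -> nat) : nat :=
  fold_right (fun i acc => (f i + acc)%nat) 0%nat (seq 0 n).

(** * Points of C^n : only the components 0 .. n-1 are used *)
Definition cvec : Type := nat -> C.
Definition czero : cvec := fun _ => C0.
Definition vadd (z w : cvec) : cvec := fun i => Cadd (z i) (w i).
Definition vscale (c : C) (v : cvec) : cvec := fun i => Cmul c (v i).

Definition norm2 (n : nat) (z : cvec) : R := Rsum n (fun i => Cnorm2 (z i)).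
Definition bilin (n : nat) (z : cvec) : C := Csum n (fun i => Cmul (z i) (z i)).

Definition in_ball (n : nat) (z : cvec) : Prop := norm2 n z < 1.
Definition D4_fun (m : nat) (Z : cvec) : R :=
  1 - norm2 m Z + / 4 * Cnorm2 (bilin m Z).
Definition in_D4 (m : nat) (Z : cvec) : Prop :=
  norm2 m Z < 2 /\ D4_fun m Z > 0.

(** * log of the Bergman kernels (the positive normalising constants c, c'
      only add a constant to log K and do not affect the Bergman metric) *)
Definition logK_ball (n : nat) (z : cvec) : R :=
  - INR (n + 1) * ln (1 - norm2 n z).
Definition logK_D4 (m : nat) (Z : cvec) : R :=
  - INR m * ln (D4_fun m Z).

(** * Levi form (complex Hessian)  ∂∂̄ g (z)(v, \bar v) = Σ g_{i \bar j} v_i \bar v_j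
      = (1/4) Δ_τ g(z + τ v) at τ = 0 (τ = s + i u complex). *)
Definition second_deriv0 (f : R -> R) (l : R) : Prop :=
  exists (f1 : R -> R) (delta : R), delta > 0 /\
    (forall t, Rabs t < delta -> derivable_pt_lim f t (f1 t)) /\
    derivable_pt_lim f1 0 l.

Definition levi (g : cvec -> R) (z v : cvec) (l : R) : Prop :=
  exists l1 l2 : R,
    second_deriv0 (fun t => g (vadd z (vscale (RtoC t) v))) l1 /\
    second_deriv0 (fun t => g (vadd z (vscale (RtoC t) (vscale Ci v)))) l2 /\
    l = / 4 * (l1 + l2).

(** F^* ω_{D} = λ ω_{B}: for holomorphic F, F^* (√-1 ∂∂̄ log K_D) = √-1 ∂∂̄ (log K_D ∘ F),
    and two real (1,1)-forms agree iff their Levi (Hermitian) forms agree. *)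
Definition holo_isometry (n m : nat) (F : cvec -> cvec) : Prop :=
  exists lam : R, lam > 0 /\
    forall z v : cvec, in_ball n z ->
      exists l : R,
        levi (logK_ball n) z v l /\
        levi (fun w => logK_D4 m (F w)) z v (lam * l).

Definition cpoly : Type := list (C * (nat -> nat)).
Definition monom (n : nat) (alpha : nat -> nat) (z : cvec) : C :=
  Cprod n (fun i => Cpow (z i) (alpha i)).
Definition poly_eval (n : nat) (p : cpoly) (z : cvec) : C :=
  fold_right (fun tm acc => Cadd (Cmul (fst tm) (monom n (snd tm) z)) acc) C0 p.
Definition poly_deg_le (n d : nat) (p : cpoly) : Prop :=
  forall tm, In tm p -> (nsum n (snd tm) <= d)%nat.

(** F = (P_1,...,P_m)/R on the ball, with deg P_j, deg R <= d and R nonvanishing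
    on the ball (so F is holomorphic on the ball). *)
Definition rat_repr_deg_le (n m d : nat) (F : cvec -> cvec) : Prop :=
  exists (P : nat -> cpoly) (Rp : cpoly),
    poly_deg_le n d Rp /\ (forall j, (j < m)%nat -> poly_deg_le n d (P j)) /\
    forall z, in_ball n z ->
      poly_eval n Rp z <> C0 /\
      forall j, (j < m)%nat -> F z j = Cdiv (poly_eval n (P j) z) (poly_eval n Rp z).

Definition is_rational_map (n m : nat) (F : cvec -> cvec) : Prop :=
  exists d, rat_repr_deg_le n m d F.

(** deg(F) (lowest terms) = least d admitting such a representation. *)
Definition rat_degree (n m : nat) (F : cvec -> cvec) (d : nat) : Prop :=
  rat_repr_deg_le n m d F /\ forall d', rat_repr_deg_le n m d' F -> (d <= d')%nat.

Definition is_linear_map (n m : nat) (F : cvec -> cvec) : Prop :=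
  exists A : nat -> nat -> C, forall z, in_ball n z ->
    forall j, (j < m)%nat -> F z j = Csum n (fun i => Cmul (A j i) (z i)).

(* Main.v *)
(** Put h = (1/2) F.F, so that the kernel function of the target along F is
    1 - |F|^2 + |h|^2.  On a complex line t |-> t x every F_j is rational, and the isometry
    condition says that N(t, conj t) = |R|^4 (1 - |F|^2 + |h|^2) solves a Liouville equation,
    an identity between polynomials in the independent variables t and conj t.  Since F(0) = 0,
    the solution has a rational logarithmic derivative with an integral residue, whence
    1 - |F|^2 + |h|^2 = (1 - |z|^2)^k for an integer k > 0.  Polarizing and testing with a
    second-order functional that kills h (possible as n >= 2) gives k = 1, that is
    <F(z), F(w)> = h(z) conj(h(w)) + <z, w>.
    Hence either F is linear or F = h al + be(z) with |al| = 1, be linear isometric and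
    orthogonal to al.  Then 2 h = A h^2 + 2 B h + Q with A constant, B linear and Q quadratic.
    If A <> 0, rationality of h along lines makes the discriminant (1 - B t)^2 - A Q t^2 a
    square, so Q = 0 and h = 0; if A = 0 then h = Q / (2 (1 - B)), which has degree 2. *)
Require Import Defs.
From Stdlib Require Import Reals.
From Stdlib Require Import Lra.
From Stdlib Require Classical_Prop.
From mathcomp Require all_boot all_order all_algebra.
From mathcomp Require ring.
From mathcomp Require complex Rstruct.
Open Scope R_scope.

(* The MathComp notations (boolean [<=] on [nat], [+] in [ring_scope], ...) stay confined to
   this module, so that the final statement is read with the Stdlib ones. *)
Module BallToType4.
Import all_boot all_order all_algebra.
Import ring complex Rstruct.
Set Implicit Arguments. Unset Strict Implicit. Unset Printing Implicit Defensive.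
Import Order.TTheory GRing.Theory Num.Theory.
Local Open Scope ring_scope.

(** * Polynomials and the Liouville equation on a disc *)

(** The isometry condition supplies, at each point and direction, only a sum of two real second
    derivatives. Analysis is therefore confined to logarithms of one-variable polynomials.
    Everything else is algebra in t and s, where s stands for the conjugate of t. The factor |R|^4
    costs nothing, since its logarithm has zero mixed derivative. With M = 1 - rho t s the condition
    reads d_t d_s log N = lam d_t d_s log M, where lam is the isometry constant times (n + 1) / m.
    The way around is the derivative of log(N / M^lam) in s, a fraction of polynomials for any lam:
    it turns out to depend on s alone, and lam is then read off as a difference of degrees. As lam
    is the same on all lines, so is k. Two axes are needed to exclude k >= 2: on a plane, a rank-one
    Hermitian form minus a positive definite one takes a negative value, and a Gram form does
    not. *)

Lemma poly_eq0_small (K : numFieldType) (p : {poly K}) (d : K) : 0 < d ->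
  (forall t, 0 < t < d -> p.[t] = 0) -> p = 0.
Proof.
move=> d0 H; apply/eqP; apply: contraT => pN0.
(* The sample points are d/2, d/3, ...: the shift by 2 keeps them strictly below [d], and there are
   [size p] of them, one more than the degree. *)
pose s := [seq d / (i.+2)%:R | i <- iota 0 (size p)].
have us : uniq s.
  rewrite map_inj_uniq ?iota_uniq // => i j /(mulfI (lt0r_neq0 d0)) /invr_inj /eqP.
  by rewrite eqr_nat => /eqP [].
have rs : all (root p) s.
  apply/allP => _ /mapP [i _ ->]; apply/rootP/H.
  rewrite divr_gt0 //= ltr_pdivrMr ?ltr0n // ltr_pMr // ltr1n //.
by have := max_poly_roots pN0 rs us; rewrite size_map size_iota ltnn.
Qed.

(** Constancy of x / y without fractions or integration: [d] vanishes at 0 and satisfies d' y = d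
    y', so once the coefficients of d up to i are zero, degree i of this equation reads (i + 1)
    d_(i+1) y_0 = 0. Over a general domain, the coefficients may be polynomials in a second
    variable. *)
Lemma proportional_of_wronskian0 (A : idomainType) (x y : {poly A}) :
  (forall i, (i.+1)%:R != 0 :> A) -> x^`() * y = x * y^`() -> y`_0 != 0 ->
  y`_0 *: x = x`_0 *: y.
Proof.
move=> char0 H y0; apply/eqP; rewrite -subr_eq0; apply/eqP.
set d := _ - _.
have dE : d^`() * y = d * y^`().
  by rewrite /d !derivE mulrBl mulrBl -!scalerAl H; congr (_ - _); rewrite [y * _]mulrC.
suff dz i j : (j <= i)%N -> d`_j = 0 by apply/polyP => i; rewrite coef0 (dz i).
elim: i j => [|i IH] j.
  by rewrite leqn0 => /eqP ->; rewrite /d coefB !coefZ mulrC subrr.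
rewrite leq_eqVlt ltnS => /orP [/eqP -> |]; last exact: IH.
have /(congr1 (fun q : {poly A} => q`_i)) := dE.
rewrite !coefM [RHS]big1 => [|k _]; last by rewrite IH ?mul0r // -ltnS.
rewrite big_ord_recr /= big1 => [|k _]; last first.
  by rewrite coef_deriv IH ?mul0rn ?mul0r.
rewrite add0r subnn coef_deriv => /eqP; rewrite mulf_eq0 (negPf y0) orbF.
by rewrite -mulr_natr mulf_eq0 (negPf (char0 _)) orbF => /eqP.
Qed.

Lemma coefM_top (A : nzRingType) (x y : {poly A}) p q :
  (size x <= p.+1)%N -> (size y <= q.+1)%N -> (x * y)`_(p + q) = x`_p * y`_q.
Proof.
move=> sx sy; rewrite coefM.
have pP : (p < (p + q).+1)%N by rewrite ltnS leq_addr.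
rewrite (bigD1 (Ordinal pP)) //= addKn big1 ?addr0 // => i /eqP ne.
have [lt|lt|e] := ltngtP (i : nat) p.
- rewrite [y`__]nth_default ?mulr0 //; apply: leq_trans sy _.
  by rewrite ltn_subRL ltn_add2r.
- by rewrite nth_default ?mul0r //; apply: leq_trans sx _.
- by case: ne; apply: val_inj.
Qed.

(* comparing leading coefficients: the exponent of the logarithmic derivative at the
   pole 1/c is an integer *)
Lemma log_derivative_exponent (A : idomainType) (a b : {poly A}) (c l : A) :
  a != 0 -> b != 0 -> c != 0 ->
  (a^`() * b - a * b^`()) * (1 - c *: 'X) = - (l * c) *: (a * b) ->
  l + (size b).-1%:R = (size a).-1%:R.
Proof.
move=> a0 b0 c0 H.
set p := (size a).-1; set q := (size b).-1.
have sa : (size a <= p.+1)%N by rewrite /p prednK // size_poly_gt0.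
have sb : (size b <= q.+1)%N by rewrite /q prednK // size_poly_gt0.
have sd (u : {poly A}) r : (size u <= r.+1)%N -> (size u^`() <= r)%N.
  by move=> h; apply: leq_trans (size_poly _ _) _; rewrite -subn1 leq_subLR add1n.
have sdX (u : {poly A}) r : (size u <= r.+1)%N -> (size (u^`() * 'X)%R <= r.+1)%N.
  move=> h; apply: leq_trans (size_polyMleq _ _) _; rewrite size_polyX addn2 /=.
  by rewrite ltnS sd.
have cdX (u : {poly A}) r : (u^`() * 'X)`_r = u`_r *+ r.
  by rewrite coefMX; case: r => [|r] /=; rewrite ?mulr0n ?coef_deriv.
have E : a^`() * b - a * b^`() - c *: ((a^`() * 'X) * b - a * (b^`() * 'X))
   = - (l * c) *: (a * b).
  by rewrite -H -!mul_polyC; ring.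
have /(congr1 (fun u : {poly A} => u`_(p + q))) := E.
rewrite coefB coefZ !coefB coefZ !coefM_top ?sdX //; do 2?[by apply: leqW; apply: sd].
rewrite !cdX [a^`()`_p]nth_default ?sd // [b^`()`_q]nth_default ?sd //.
rewrite mul0r mulr0 subrr sub0r => /eqP.
have La : a`_p != 0 by rewrite -lead_coefE lead_coef_eq0.
have Lb : b`_q != 0 by rewrite -lead_coefE lead_coef_eq0.
rewrite mulNr eqr_opp -mulr_natr -[b`_q *+ _]mulr_natr => /eqP H1.
have /eqP : (c * a`_p * b`_q) * (p%:R - q%:R - l) = 0.
  by rewrite -[RHS](subrr (l * c * (a`_p * b`_q))) -{1}H1; ring.
rewrite !mulf_eq0 (negPf c0) (negPf La) (negPf Lb) /= => /eqP h.
by apply/eqP; rewrite eq_sym -subr_eq0 -h; apply/eqP; ring.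
Qed.

(** In [{poly {poly F}}] the outer variable stands for t and the inner one for s; [deriv] acts on t,
    this operator on s. *)
Definition deriv_in (F : nzRingType) (u : {poly {poly F}}) := swapXY (swapXY u)^`().

Lemma bipoly_eq0 (K : numFieldType) (u : {poly {poly K}}) :
  (forall t s, u.[t%:P].[s] = 0) -> u = 0.
Proof.
move=> H; apply/polyP => i; rewrite coef0.
apply: (poly_eq0_small ltr01) => s _; rewrite -[_.[s]]/(horner_eval s u`_i) -coef_map /=.
suff -> : map_poly (horner_eval s) u = 0 by rewrite coef0.
apply: (poly_eq0_small ltr01) => t _.
by rewrite -(H t s) -[RHS]/(horner_eval s _) -horner_map /= /horner_eval hornerC.
Qed.

(** This is u^2 times the mixed derivative of log u in t and s, a form of the complex Hessian that
    stays polynomial. *)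
Definition log_hessian (F : nzRingType) (u : {poly {poly F}}) :=
  u * (deriv_in u)^`() - u^`() * deriv_in u.

Section Disc.
Variable (K : numFieldType).
Implicit Types (N u v : {poly {poly K}}) (a b : {poly K}).

(** The polarization of 1 - |t x|^2 on the line spanned by x, with rho = |x|^2. *)
Definition ball_poly (rho : K) : {poly {poly K}} := 1 - (rho *: 'X)%:P * 'X.

Lemma poly_natr_neq0 i : (i.+1)%:R != 0 :> {poly K}.
Proof. by rewrite -polyC_natr polyC_eq0 pnatr_eq0. Qed.

Lemma swap_ball_poly rho : swapXY (ball_poly rho) = ball_poly rho.
Proof.
rewrite /ball_poly rmorphB rmorph1 rmorphM /= swapXY_X swapXY_polyC map_polyZ map_polyX /=.
by rewrite -!mul_polyC polyCM; ring.
Qed.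

Lemma deriv_ball_poly rho : (ball_poly rho)^`() = - (rho *: 'X)%:P.
Proof. by rewrite /ball_poly -[1]/(1%:P) !derivE; rewrite ?mulr1 ?sub0r ?mul0r ?add0r. Qed.

Lemma horner0_ball_poly rho : (ball_poly rho).[0] = 1.
Proof. by rewrite /ball_poly hornerD hornerN hornerM hornerX mulr0 subr0 hornerC. Qed.

Lemma horner_ball_poly rho t s : (ball_poly rho).[t%:P].[s] = 1 - rho * s * t.
Proof. by rewrite /ball_poly !hornerE; ring. Qed.

Lemma log_hessian_ball_poly rho t s : (log_hessian (ball_poly rho)).[t%:P].[s] = - rho.
Proof.
have dM : deriv_in (ball_poly rho) = - (rho%:P%:P * 'X).
  rewrite /deriv_in swap_ball_poly deriv_ball_poly rmorphN /= swapXY_polyC map_polyZ map_polyX.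
  by rewrite -mul_polyC.
rewrite /log_hessian dM deriv_ball_poly derivN derivM derivC derivX mul0r add0r mulr1.
by rewrite hornerD !hornerN !hornerM hornerD hornerN !hornerM horner_ball_poly !hornerE; ring.
Qed.

(** The logarithm of a(t) b(s) is a sum of functions of one variable each, so its mixed derivative
    is zero. *)
Lemma log_hessian_split a b : log_hessian (a^:P * b%:P) = 0.
Proof.
have -> : log_hessian (a^:P * b%:P) = a^:P * b%:P * (a^:P * (b^`())%:P)^`()
    - (a^:P * b%:P)^`() * (a^:P * (b^`())%:P).
  suff e : deriv_in (a^:P * b%:P) = a^:P * (b^`())%:P by rewrite /log_hessian e.
  rewrite /deriv_in rmorphM /= swapXY_map_polyC swapXY_polyC.
  rewrite derivM derivC mul0r add0r rmorphM /= swapXY_polyC.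
  by rewrite deriv_map swapXY_map_polyC.
by rewrite !derivM !derivC !mulr0 !addr0; ring.
Qed.

(** With M = [ball_poly rho], the equation says that log N - lam log M has zero mixed derivative,
    which suggests N = a(t) b(s) M^lam. The values at t = 0 and s = 0 fix the two factors; lam is
    shown to be an integer before any power of M is taken, and [0 <= lam] makes it a natural
    number. *)
Lemma liouville_disc N a b (rho lam : K) :
  0 <= lam -> rho != 0 -> a.[0] != 0 -> b.[0] != 0 ->
  N.[0] = a.[0] *: b -> (swapXY N).[0] = b.[0] *: a ->
  ball_poly rho ^+ 2 * log_hessian N + (rho * lam)%:P%:P * N ^+ 2 = 0 ->
  exists k : nat, lam = k%:R /\
    forall t s, N.[t%:P].[s] = a.[t] * b.[s] * (1 - rho * s * t) ^+ k.
Proof.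
move=> lam0 rho0 a0 b0 N0s Nt0 W.
have bn0 : b != 0 by apply: contraNneq b0 => ->; rewrite horner0.
have an0 : a != 0 by apply: contraNneq a0 => ->; rewrite horner0.
set M := ball_poly rho in W *.
(* X / Y is the derivative of log(N / M^lam) in s; the hypothesis is the vanishing of the Wronskian
   of X and Y in t. *)
pose X := deriv_in N * M + (lam * rho)%:P%:P * 'X * N.
pose Y := N * M.
have WXY : X^`() * Y = X * Y^`().
  have dM : M^`() = - (rho%:P%:P * 'Y) by rewrite deriv_ball_poly -mul_polyC polyCM.
  have ME : M = 1 - rho%:P%:P * 'Y * 'X by rewrite /M /ball_poly -mul_polyC polyCM.
  have -> : Y^`() = N^`() * M + N * M^`() by rewrite derivM.
  have -> : X^`() = (deriv_in N)^`() * M + deriv_in N * M^`()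
      + (lam * rho)%:P%:P * N + (lam * rho)%:P%:P * 'X * N^`().
    by rewrite /X derivD !derivM derivX derivC; ring.
  apply/eqP; rewrite -subr_eq0; apply/eqP; rewrite -[RHS]W /log_hessian /X /Y dM ME !polyCM; ring.
have Y0 : Y`_0 = a.[0] *: b.
  by rewrite -horner_coef0 /Y hornerM N0s horner0_ball_poly mulr1.
have X0 : X`_0 = a.[0] *: b^`().
  rewrite -horner_coef0 /X hornerD !hornerM hornerX horner0_ball_poly mulr1 mulr0 mul0r addr0.
  rewrite /deriv_in -polyC0 horner_swapXY -deriv_map -horner_polyC polyC0 N0s derivZ //.
(* At t = 0 the fraction X / Y equals b' / b, hence it does so for all t. *)
have E1 : b%:P * X = (b^`())%:P * Y.
  have Y0n : Y`_0 != 0 by rewrite Y0 scaler_eq0 (negPf a0).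
  have := proportional_of_wronskian0 poly_natr_neq0 WXY Y0n.
  rewrite Y0 X0 -!mul_polyC !polyCM -!mulrA => /mulfI; apply.
  by rewrite !polyC_eq0.
(* The variables are exchanged: the outer one is now s, and [E1] becomes an equation for the
   logarithmic derivative of A1 / B1 in s, with a single pole coming from M. *)
pose A1 : {poly {poly K}} := swapXY N; pose B1 : {poly {poly K}} := b^:P.
have E2 : B1 * (A1^`() * M + (lam * rho)%:P%:P * 'X%:P * A1) = B1^`() * (A1 * M).
  have sM : swapXY M = M := swap_ball_poly rho.
  have sX : swapXY X = A1^`() * M + (lam * rho)%:P%:P * 'X%:P * A1.
    rewrite /X raddfD /= [swapXY (deriv_in N * M)]rmorphM /= sM /deriv_in swapXYK.
    by rewrite rmorphM /= rmorphM /= swapXY_X swapXY_polyC map_polyC.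
  have /(congr1 swapXY) := E1.
  rewrite rmorphM [RHS]rmorphM /= [swapXY Y]rmorphM /= sM sX !swapXY_polyC.
  by rewrite /B1 deriv_map.
have A1n0 : A1 != 0.
  apply/negP => /eqP h; move: Nt0; rewrite -/A1 h horner0 => /esym/eqP.
  by rewrite scaler_eq0 (negPf b0) (negPf an0).
have B1n0 : B1 != 0 by rewrite /B1 map_polyC_eq0.
have ME : M = 1 - (rho *: 'X) *: 'X by rewrite /M /ball_poly mul_polyC.
have E3 : (A1^`() * B1 - A1 * B1^`()) * M = - (lam%:P * (rho *: 'X)) *: (A1 * B1).
  apply/eqP; rewrite -subr_eq0; move/eqP: E2; rewrite -subr_eq0 => /eqP <-; apply/eqP.
  rewrite -!mul_polyC !polyCM polyCN !polyCM; ring.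
have cn0 : rho *: 'X != 0 :> {poly K} by rewrite scaler_eq0 (negPf rho0) polyX_eq0.
have E3' := E3; rewrite ME in E3'.
have := log_derivative_exponent A1n0 B1n0 cn0 E3'.
set p := (size A1).-1; set q := (size B1).-1.
rewrite -!polyC_natr -polyCD => /polyC_inj lE.
have qp : (q <= p)%N by rewrite -(ler_nat K) -lE lerDr.
have lamE : lam = (p - q)%:R by rewrite natrB // -lE addrK.
move: (p - q)%N lamE => k lamE; exists k; split => //.
(* Now that M^k is a polynomial, A1 and B1 M^k have the same logarithmic derivative in s, so they
   are proportional, with the ratio found at s = 0. *)
have WAB : A1^`() * (B1 * M ^+ k) = A1 * (B1 * M ^+ k)^`().
  case: k lamE => [|k] lamE.
    rewrite expr0 !mulr1.
    have := E3; rewrite lamE polyC0 mul0r oppr0 scale0r => /eqP; rewrite mulf_eq0.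
    suff /negPf -> : M != 0 by rewrite orbF subr_eq0 => /eqP.
    by apply/eqP => /(congr1 (fun u : {poly {poly K}} => u.[0])) /eqP;
      rewrite horner0_ball_poly horner0 oner_eq0.
  apply/eqP; rewrite -subr_eq0 derivM deriv_exp /= deriv_ball_poly -mulr_natr exprS.
  have -> : A1^`() * (B1 * (M * M ^+ k)) - A1 * (B1^`() * (M * M ^+ k) +
      B1 * (- (rho *: 'X)%:P * M ^+ k * k.+1%:R)) =
      M ^+ k * ((A1^`() * B1 - A1 * B1^`()) * M + k.+1%:R * (rho *: 'X)%:P * (A1 * B1)) by ring.
  have lamP : lam%:P%:P = k.+1%:R :> {poly {poly K}} by rewrite lamE !polyC_natr.
  by rewrite E3 -mul_polyC polyCN polyCM lamP; apply/eqP; ring.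
have B20 : (B1 * M ^+ k)`_0 = b.[0]%:P.
  rewrite -horner_coef0 hornerM horner_exp horner0_ball_poly expr1n mulr1.
  by rewrite /B1 -polyC0 horner_map.
have B20n : (B1 * M ^+ k)`_0 != 0 by rewrite B20 polyC_eq0.
have := proportional_of_wronskian0 poly_natr_neq0 WAB B20n.
rewrite B20 -[A1`_0]horner_coef0 Nt0 => E4 t s.
have := congr1 (fun u : {poly {poly K}} => u.[s%:P].[t]) E4.
have hM : M.[s%:P].[t] = 1 - rho * s * t.
  by rewrite /M /ball_poly !hornerE; ring.
rewrite /= !hornerZ !hornerM !horner_exp hM hornerC hornerZ.
rewrite /A1 horner2_swapXY /B1 horner_map /= hornerC => E5.
by apply: (mulfI b0); rewrite E5; ring.
Qed.
End Disc.

(** * Polarization and the exponent *)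

Section LinePoly.
Variables (K : numClosedFieldType) (n : nat).
Notation V := 'rV[K]_n.
Implicit Types (z w : V) (f g : V -> K) (Psi : V -> V -> K).

Definition conjv z : V := map_mx Num.conj z.
Definition hdot (z w : V) : K := \sum_i z 0 i * (w 0 i)^*.
Definition hnorm2 z : K := hdot z z.

(** Polynomiality is asked only on complex lines: this is stable under the operations used and
    reduces every argument to one variable. *)
Definition line_poly f := forall a b : V, exists q : {poly K}, forall t, f (a + t *: b) = q.[t].
Definition biline_poly Psi :=
  forall a b a' b' : V, exists q : {poly K}, forall t, Psi (a + t *: b) (a' + t *: b') = q.[t].

Lemma conjvK : involutive conjv.
Proof. by move=> z; apply/rowP => i; rewrite !mxE conjCK. Qed.

Lemma conjvZ c z : conjv (c *: z) = c^* *: conjv z.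
Proof. by apply/rowP => i; rewrite !mxE rmorphM. Qed.

Lemma conjvDZ (a b : V) t : conjv (a + t *: b) = conjv a + t^* *: conjv b.
Proof. by apply/rowP => i; rewrite !mxE rmorphD rmorphM. Qed.

Lemma hnorm2_ge0 z : 0 <= hnorm2 z.
Proof. by apply: sumr_ge0 => i _; apply: mul_conjC_ge0. Qed.

Lemma hnorm2Z t z : hnorm2 (t *: z) = t * t^* * hnorm2 z.
Proof. by rewrite /hnorm2 /hdot mulr_sumr; apply: eq_bigr => i _; rewrite !mxE rmorphM; ring. Qed.

Lemma hnorm2_0 : hnorm2 0 = 0.
Proof. by rewrite /hnorm2 /hdot big1 // => i _; rewrite mxE mul0r. Qed.

Lemma hnorm2_eq0 z : hnorm2 z = 0 -> z = 0.
Proof.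
move=> /eqP; rewrite psumr_eq0 => [/allP H|i _]; last exact: mul_conjC_ge0.
by apply/rowP => i; have := H i (mem_index_enum _); rewrite /= mul_conjC_eq0 mxE => /eqP.
Qed.

Lemma line_poly_conj f : line_poly f -> line_poly (fun w => (f (conjv w))^*).
Proof.
move=> Hf a b; have [q Hq] := Hf (conjv a) (conjv b).
exists (map_poly Num.conj q) => t; rewrite conjvDZ Hq.
by rewrite -{2}[t]conjCK horner_map.
Qed.

Lemma line_polyM f g : line_poly f -> line_poly g -> line_poly (fun z => f z * g z).
Proof.
by move=> Hf Hg a b; have [p Hp] := Hf a b; have [q Hq] := Hg a b;
  exists (p * q) => t; rewrite Hp Hq hornerM.
Qed.

Lemma line_poly_sum (I : finType) (f : I -> V -> K) :
  (forall i, line_poly (f i)) -> line_poly (fun z => \sum_i f i z).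
Proof.
move=> H a b; have [q Hq] := fin_all_exists (fun i => H i a b).
by exists (\sum_i q i) => t; rewrite horner_sum; apply: eq_bigr => i _; rewrite Hq.
Qed.

Lemma line_poly_cst c : line_poly (fun _ => c).
Proof. by move=> a b; exists c%:P => t; rewrite hornerC. Qed.

Lemma line_poly_coord i : line_poly (fun z => z 0 i).
Proof.
by move=> a b; exists ((a 0 i)%:P + (b 0 i) *: 'X) => t; rewrite !mxE !hornerE; ring.
Qed.

Lemma biline_l f : line_poly f -> biline_poly (fun z _ => f z).
Proof. by move=> H a b a' b'; have [q Hq] := H a b; exists q. Qed.

Lemma biline_r f : line_poly f -> biline_poly (fun _ w => f w).
Proof. by move=> H a b a' b'; have [q Hq] := H a' b'; exists q. Qed.

Lemma bilineM Psi Phi : biline_poly Psi -> biline_poly Phi ->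
  biline_poly (fun z w => Psi z w * Phi z w).
Proof.
by move=> H H' a b a' b'; have [p Hp] := H a b a' b'; have [q Hq] := H' a b a' b';
  exists (p * q) => t; rewrite Hp Hq hornerM.
Qed.

Lemma bilineB Psi Phi : biline_poly Psi -> biline_poly Phi ->
  biline_poly (fun z w => Psi z w - Phi z w).
Proof.
by move=> H H' a b a' b'; have [p Hp] := H a b a' b'; have [q Hq] := H' a b a' b';
  exists (p - q) => t; rewrite Hp Hq hornerD hornerN.
Qed.

Lemma bilineX Psi k : biline_poly Psi -> biline_poly (fun z w => Psi z w ^+ k).
Proof.
by move=> H a b a' b'; have [p Hp] := H a b a' b'; exists (p ^+ k) => t;
  rewrite Hp horner_exp.
Qed.

Lemma biline_sum (I : finType) (Psi : I -> V -> V -> K) :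
  (forall i, biline_poly (Psi i)) -> biline_poly (fun z w => \sum_i Psi i z w).
Proof.
move=> H a b a' b'; have [q Hq] := fin_all_exists (fun i => H i a b a' b').
by exists (\sum_i q i) => t; rewrite horner_sum; apply: eq_bigr => i _; rewrite Hq.
Qed.

Lemma small_line_in_ball (a b : V) : exists2 d : K, 0 < d &
  forall s t, 0 < s < d -> 0 < t < 1 -> hnorm2 (s *: a + t *: (s *: b)) < 1.
Proof.
(* M bounds |a + t b|^2 for 0 < t < 1, and s < 1 / (1 + M) gives s^2 M < 1. *)
pose M := \sum_i (`|a 0 i| + `|b 0 i|) ^+ 2.
have M0 : 0 <= M by apply: sumr_ge0 => i _; rewrite exprn_ge0 ?addr_ge0.
have M1 : 0 < 1 + M by rewrite ltr_wpDr.
exists (1 + M)^-1; first by rewrite invr_gt0.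
move=> s t /andP [s0 sd] /andP [t0 t1].
have sM : s * (1 + M) < 1 by rewrite -ltr_pdivlMr // div1r.
have s1 : s < 1 by apply: lt_le_trans sd _; rewrite invf_le1 // lerDl.
have -> : s *: a + t *: (s *: b) = s *: (a + t *: b).
  by rewrite scalerDr !scalerA [s * t]mulrC.
rewrite hnorm2Z (CrealP (gtr0_real s0)).
have le : hnorm2 (a + t *: b) <= M.
  apply: ler_sum => i _; rewrite -normCK !mxE lerXn2r ?nnegrE ?addr_ge0 //.
  apply: le_trans (ler_normD _ _) _; rewrite lerD2l normrM gtr0_norm //.
  by rewrite ler_piMl // ltW.
apply: le_lt_trans (_ : s * s * M < 1); first by rewrite ler_wpM2l // mulr_ge0 // ltW.
apply: le_lt_trans sM; rewrite -mulrA ler_pM2l //.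
apply: le_trans (_ : 1 * M <= _); first by rewrite ler_wpM2r // ltW.
by rewrite mul1r lerDr.
Qed.

(* A pair (z, w) is a complex affine combination, at t = i, of points (u, conj u). *)
Lemma polarization Psi : biline_poly Psi ->
  (forall z, hnorm2 z < 1 -> Psi z (conjv z) = 0) -> forall z w, Psi z w = 0.
Proof.
move=> HPsi H0 z w.
have i0 : ('i : K) != 0 by rewrite neq0Ci.
have two0 : (2 : K) != 0 by rewrite pnatr_eq0.
pose a : V := 2^-1 *: (z + conjv w); pose b : V := (2 * 'i)^-1 *: (z - conjv w).
have Ez : a + 'i *: b = z.
  by apply/rowP => i; rewrite !mxE; field; rewrite ?i0 ?two0.
have Ew : conjv a + 'i *: conjv b = w.
  apply/rowP => i; rewrite !mxE !rmorphM rmorphD rmorphB !fmorphV rmorphM /= conjCi conjCK.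
  by rewrite conjC_nat; field; rewrite ?i0 ?two0.
have [d d0 Hd] := small_line_in_ball a b.
(* The points (u, conj u) must have u in the ball, so (z, w) is shrunk by a small s; polynomiality
   in s carries the vanishing back to s = 1. *)
have [q Hq] := HPsi 0 z 0 w.
suff q0 : q = 0 by have := Hq 1; rewrite !add0r !scale1r q0 horner0.
apply: (poly_eq0_small d0) => s sd.
have sR : s^* = s by apply: CrealP; rewrite gtr0_real //; case/andP: sd.
have [r Hr] := HPsi (s *: a) (s *: b) (s *: conjv a) (s *: conjv b).
have r0 : r = 0.
  apply: (poly_eq0_small ltr01) => t t01; rewrite -Hr.
  have tR : t^* = t by apply: CrealP; rewrite gtr0_real //; case/andP: t01.
  rewrite -[RHS](H0 (s *: a + t *: (s *: b))) ?Hd // conjvDZ tR.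
  by rewrite !conjvZ sR.
rewrite -Hq !add0r -Ez -Ew !scalerDr !scalerA ![s * 'i]mulrC -!scalerA Hr r0 horner0 //.
Qed.

End LinePoly.

Section Exponent.
Variables (K : numClosedFieldType).

Lemma poly_ext (p q : {poly K}) : (forall t, p.[t] = q.[t]) -> p = q.
Proof.
move=> H; apply/eqP; rewrite -subr_eq0; apply/eqP.
by apply: (poly_eq0_small ltr01) => t _; rewrite hornerD hornerN H subrr.
Qed.

Lemma coef_1subX_exp (c : K) k (q := (1 - c *: 'X) ^+ k) :
  [/\ q`_0 = 1, q`_1 = - (k%:R * c) & q`_2 = 'C(k, 2)%:R * c ^+ 2].
Proof.
rewrite {}/q; elim: k => [|k [IH0 IH1 IH2]].
  by rewrite expr0 !coef1 bin0n mul0r mul0r oppr0.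
rewrite exprSr mulrBr mulr1 -scalerAr !coefB !coefZ !coefMX /= IH0 IH1 IH2.
by rewrite binS bin1 natrD -natr1; split; ring.
Qed.

(** The booleans index two orthogonal axes. On axis a, [p a j], [H a] and [s a] stand for the
    restrictions of R P_j, of half the sum of the P_j^2, and of R^2. [gram] is the polarized
    identity on a pair of axes, whose Hermitian product is t conj(u) on equal axes and 0 on distinct
    ones. *)
Variables (m : nat) (p : bool -> 'I_m -> {poly K}) (H s : bool -> {poly K}) (k : nat).
Hypothesis s0 : forall a, (s a)`_0 != 0.
Hypothesis gram : forall a b t u,
  \sum_j (p a j).[t] * ((p b j).[u])^* = (H a).[t] * ((H b).[u])^*
   + (s a).[t] * ((s b).[u])^* * (1 - (1 - (a == b)%:R * t * u^*) ^+ k).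

(* a second-order functional vanishing on [s a * 'X] *)
Let phi a (q : {poly K}) := q`_2 - (s a)`_1 / (s a)`_0 * q`_1.

Let phiD a q r : phi a (q + r) = phi a q + phi a r.
Proof. by rewrite /phi !coefD; ring. Qed.
Let phiZ a c q : phi a (c *: q) = c * phi a q.
Proof. by rewrite /phi !coefZ; ring. Qed.
Let phi_sum a (q : 'I_m -> {poly K}) : phi a (\sum_j q j) = \sum_j phi a (q j).
Proof. by rewrite /phi !coef_sum mulr_sumr -sumrB. Qed.

(** In 1 - (1 - c X)^k = k c X - C(k, 2) c^2 X^2 + ..., the linear term times [s a] is killed by
    [phi a], and only the quadratic one survives. *)
Let phi_ker a c : phi a (s a * (1 - (1 - c *: 'X) ^+ k)) = - ((s a)`_0 * 'C(k, 2)%:R * c ^+ 2).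
Proof.
have [e0 e1 e2] := coef_1subX_exp c k.
rewrite /phi !coefM !big_ord_recl !big_ord0 /= !coefB !coef1 /= e0 e1 e2.
by have := s0 a; move=> h; field.
Qed.

Let phi_X2 a : phi a (s a * 'X^2) = (s a)`_0.
Proof. by rewrite /phi !coefMXn /= mulr0 subr0. Qed.

(** Applying [phi a] in t and then [phi b] in the conjugate of u turns the polynomial identity into
    one between 2 by 2 Hermitian matrices. *)
Let phi_gram a b : \sum_j phi a (p a j) * (phi b (p b j))^* =
  phi a (H a) * (phi b (H b))^* - (a == b)%:R * 'C(k, 2)%:R * ((s a)`_0 * ((s b)`_0)^*).
Proof.
have E1 u : \sum_j phi a (p a j) * ((p b j).[u])^* = phi a (H a) * ((H b).[u])^*
    - (s a)`_0 * ((s b).[u])^* * 'C(k, 2)%:R * (a == b)%:R * (u^*) ^+ 2.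
  have E : \sum_j ((p b j).[u])^* *: p a j = ((H b).[u])^* *: H a +
     ((s b).[u])^* *: (s a * (1 - (1 - ((a == b)%:R * u^*) *: 'X) ^+ k)).
    apply: poly_ext => t; transitivity (\sum_j (p a j).[t] * ((p b j).[u])^*).
      by rewrite horner_sum; apply: eq_bigr => j _; rewrite hornerZ mulrC.
    by rewrite gram [_ * t * u^*]mulrAC !hornerE /=; ring.
  have := congr1 (phi a) E; rewrite phi_sum phiD !phiZ phi_ker => E2.
  transitivity (\sum_j phi a (((p b j).[u])^* *: p a j)).
    by apply: eq_bigr => j _; rewrite phiZ mulrC.
  rewrite E2; by case: (a == b); rewrite /= ?mulr1n ?mulr0n; ring.
have E : \sum_j (phi a (p a j))^* *: p b j + (((s a)`_0)^* * 'C(k, 2)%:R * (a == b)%:R) *: (s b * 'X^2)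
    = (phi a (H a))^* *: H b.
  apply: poly_ext => u; have /(congr1 (fun x => x^*)) := E1 u.
  rewrite rmorphB !rmorphM /= !conjCK !conjC_nat rmorph_sum /=.
  rewrite hornerD !hornerZ hornerM hornerXn horner_sum => E3.
  rewrite (eq_bigr (fun j => (phi a (p a j) * ((p b j).[u])^*)^*)) => [|j _].
    by rewrite E3; ring.
  by rewrite hornerZ rmorphM /= conjCK.
have /(congr1 (fun x => x^*)) := congr1 (phi b) E.
rewrite phiD phi_sum !phiZ phi_X2 rmorphD rmorph_sum !rmorphM /= !conjCK !conjC_nat.
move=> E4; apply/eqP; rewrite eq_sym subr_eq eq_sym; apply/eqP.
transitivity (\sum_j (phi b ((phi a (p a j))^* *: p b j))^* +
   (s a)`_0 * 'C(k, 2)%:R * (a == b)%:R * ((s b)`_0)^*); last by rewrite E4.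
congr (_ + _); last by ring.
by apply: eq_bigr => j _; rewrite phiZ rmorphM /= conjCK.
Qed.

(** For k >= 2 the matrix of [phi_gram] would be a rank-one matrix minus a positive diagonal one. In
    dimension two the rank-one part has a nonzero kernel vector, and the corresponding combination
    of the vectors would have negative square norm. *)
Lemma gram_exponent_le1 : (k <= 1)%N.
Proof.
rewrite leqNgt; apply/negP => k2.
have C0 : 0 < 'C(k, 2)%:R :> K by rewrite ltr0n bin_gt0.
(* (c, c') annihilates the two values of [phi] on [H]: it is the crossed pair, or (1, 0) when the
   first value is zero. *)
have [c [c' [cc0 ccH]]] : exists c c' : K,
    0 < c * c^* + c' * c'^* /\ c * phi true (H true) + c' * phi false (H false) = 0.
  case: (eqVneq (phi true (H true)) 0) => [->|h].
    by exists 1, 0; rewrite rmorph1 mulr1 mul0r addr0 ltr01 mulr0 mul0r addr0.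
  exists (phi false (H false)), (- phi true (H true)); split; last by ring.
  by rewrite ltr_wpDl ?mul_conjC_ge0 // mul_conjC_gt0 oppr_eq0.
pose v j := c * phi true (p true j) + c' * phi false (p false j).
have vv : \sum_j v j * (v j)^* = (c * phi true (H true) + c' * phi false (H false)) *
   (c * phi true (H true) + c' * phi false (H false))^* -
   'C(k, 2)%:R * (c * c^* * ((s true)`_0 * ((s true)`_0)^*)
      + c' * c'^* * ((s false)`_0 * ((s false)`_0)^*)).
  have -> : \sum_j v j * (v j)^* =
      c * c^* * (\sum_j phi true (p true j) * (phi true (p true j))^*)
    + c * c'^* * (\sum_j phi true (p true j) * (phi false (p false j))^*)
    + c' * c^* * (\sum_j phi false (p false j) * (phi true (p true j))^*)
    + c' * c'^* * (\sum_j phi false (p false j) * (phi false (p false j))^*).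
    rewrite !mulr_sumr -!big_split /=; apply: eq_bigr => j _.
    by rewrite /v rmorphD !rmorphM; ring.
  rewrite !phi_gram /=; move: (phi true (H true)) (phi false (H false)) => x y.
  by rewrite rmorphD !rmorphM /=; ring.
have : 0 <= \sum_j v j * (v j)^* by apply: sumr_ge0 => j _; apply: mul_conjC_ge0.
rewrite vv ccH mul0r sub0r oppr_ge0 pmulr_rle0 // => le0.
have st : 0 < (s true)`_0 * ((s true)`_0)^* by rewrite mul_conjC_gt0.
have sf : 0 < (s false)`_0 * ((s false)`_0)^* by rewrite mul_conjC_gt0.
suff lt0 : 0 < c * c^* * ((s true)`_0 * ((s true)`_0)^*)
      + c' * c'^* * ((s false)`_0 * ((s false)`_0)^*).
  by have := lt_le_trans lt0 le0; rewrite ltxx.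
case: (eqVneq c 0) cc0 => [->|h] cc0.
  by rewrite mul0r add0r in cc0; rewrite !mul0r add0r mulr_gt0.
apply: ltr_wpDr; first by rewrite mulr_ge0 ?mul_conjC_ge0 // ltW.
by rewrite mulr_gt0 // mul_conjC_gt0.
Qed.
End Exponent.

(** * The Gram identity and the quadratic equation for half the bilinear square *)

(** If c and c' differ, one of them is nonzero and its inverse is a simple root of the factor in
    front of S^2; its multiplicity would be even on the left and odd on the right. *)
Lemma square_split_double (K : numFieldType) (T S : {poly K}) (c c' : K) :
  T ^+ 2 = (1 - c *: 'X) * (1 - c' *: 'X) * S ^+ 2 -> S != 0 -> c = c'.
Proof.
have main (u v : K) : u != 0 -> T ^+ 2 = (1 - u *: 'X) * (1 - v *: 'X) * S ^+ 2 ->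
    S != 0 -> u = v.
  move=> u0 H S0; apply/eqP; apply: contraT => uv.
  have uE : 1 - u *: 'X = (- u) *: ('X - (u^-1)%:P).
    by rewrite -!mul_polyC mulrBr -polyCM mulNr divff // !polyCN; ring.
  have X0 : 'X - (u^-1)%:P != 0 by rewrite polyXsubC_eq0.
  pose E := (- u) *: (1 - v *: 'X).
  have Ex : ~~ root E (u^-1).
    rewrite rootE /E !hornerE mulf_eq0 oppr_eq0 (negPf u0) /=.
    by apply: contra uv; rewrite subr_eq0 eq_sym -(inj_eq (mulfI u0)) mulr1 mulrCA divff ?mulr1 // eq_sym.
  have E0 : E != 0 by apply: contraNneq Ex => ->; rewrite root0.
  have H' : T * T = ('X - (u^-1)%:P) * E * (S * S).
    by rewrite -expr2 H uE /E -!mul_polyC; ring.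
  have T0 : T != 0.
    apply/eqP => T0; move/eqP: H'; rewrite T0 mul0r eq_sym !mulf_eq0.
    by rewrite (negPf X0) (negPf E0) (negPf S0).
  have := congr1 (fun q => odd (mup (u^-1) q)) H' => /=.
  rewrite !mupM ?mulf_neq0 // (mupNroot Ex) -['X - _]expr1 mup_XsubCX eqxx.
  by rewrite !oddD !addbb.
move=> H S0; have [c0|/main] := eqVneq c 0; last by move/(_ c' H S0).
have [->|c'0] := eqVneq c' 0; first by rewrite c0.
by apply/esym/main => //; rewrite H [(1 - c *: _) * _]mulrC.
Qed.

(** Completing the square gives (A H - (1 - B X) S)^2 = ((1 - B X)^2 - A Q X^2) S^2. With r^2 = A Q
    the bracket splits into two linear factors, which must coincide, so r = 0. *)
Lemma discriminant_square (K : numClosedFieldType) (H S : {poly K}) (A B Q : K) :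
  A *: H ^+ 2 - 2 *: ((1 - B *: 'X) * H * S) + Q *: ('X ^+ 2 * S ^+ 2) = 0 ->
  A != 0 -> S != 0 -> Q = 0.
Proof.
move=> HE A0 S0; pose r := sqrtC (A * Q).
have rr : r ^+ 2 = A * Q by rewrite sqrtCK.
have E : (A *: H - (1 - B *: 'X) * S) ^+ 2
    = (1 - (B + r) *: 'X) * (1 - (B - r) *: 'X) * S ^+ 2.
  have : r%:P ^+ 2 = A%:P * Q%:P by rewrite -polyC_exp rr polyCM.
  have := congr1 (fun q => A%:P * q) HE; rewrite mulr0 -!mul_polyC => h1 h2.
  apply/eqP; rewrite -subr_eq0; apply/eqP.
  transitivity (A%:P * (A%:P * H ^+ 2 - 2%:P * ((1 - B%:P * 'X) * H * S) +
     Q%:P * ('X ^+ 2 * S ^+ 2)) + (r%:P ^+ 2 - A%:P * Q%:P) * ('X ^+ 2 * S ^+ 2)).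
    by rewrite polyC_natr; ring.
  by rewrite h1 h2 subrr mul0r addr0.
have /eqP := square_split_double E S0.
rewrite -subr_eq0 (_ : _ - _ = 2 * r); last by ring.
rewrite mulf_eq0 pnatr_eq0 /= => /eqP r0.
by move/eqP: rr; rewrite r0 expr0n /= eq_sym mulf_eq0 (negPf A0) => /eqP.
Qed.

Section Split.
Variables (K : numClosedFieldType) (n m : nat).
Notation V := 'rV[K]_n.
Variables (f : 'I_m -> V -> K) (h : V -> K).

Definition linear_form (g : 'I_n -> K) (z : V) := \sum_i g i * z 0 i.

Lemma linear_formZ g c z : linear_form g (c *: z) = c * linear_form g z.
Proof.
by rewrite /linear_form mulr_sumr; apply: eq_bigr => i _; rewrite !mxE mulrCA.
Qed.

Hypothesis gram : forall z w, hnorm2 z < 1 -> hnorm2 w < 1 ->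
  \sum_j f j z * (f j w)^* = h z * (h w)^* + hdot z w.

(** Finite formal combinations of points, evaluated through g. The Gram identity extends to
    combinations of points of the ball by sesquilinearity, although f and h are not linear. *)
Let comb (g : V -> K) (s : seq (K * V)) : K := \sum_(x <- s) x.1 * g x.2.
Let in_ballb (x : K * V) := hnorm2 x.2 < 1.

Let comb_cons g x s : comb g (x :: s) = x.1 * g x.2 + comb g s.
Proof. by rewrite /comb big_cons. Qed.
Let comb_cat g s s' : comb g (s ++ s') = comb g s + comb g s'.
Proof. by rewrite /comb big_cat. Qed.
Let scale_comb c (s : seq (K * V)) := [seq (c * x.1, x.2) | x <- s].
Let comb_scale g c s : comb g (scale_comb c s) = c * comb g s.
Proof.
by rewrite /comb big_map mulr_sumr; apply: eq_bigr => x _; rewrite mulrA.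
Qed.
Let all_scale c s : all in_ballb (scale_comb c s) = all in_ballb s.
Proof. by rewrite all_map; apply: eq_all. Qed.

Let comb_gram s s' : all in_ballb s -> all in_ballb s' ->
  \sum_j comb (f j) s * (comb (f j) s')^* =
  comb h s * (comb h s')^* + \sum_i comb (fun z => z 0 i) s * (comb (fun z => z 0 i) s')^*.
Proof.
move=> + bs'; elim: s => [|x s IH] /=.
  by rewrite /comb !big_nil mul0r add0r !big1 // => i _; rewrite big_nil mul0r.
case/andP => bx /IH {}IH.
under eq_bigr do rewrite comb_cons mulrDl.
under [in RHS]eq_bigr do rewrite comb_cons mulrDl.
rewrite !big_split /= IH comb_cons mulrDl addrACA; congr (_ + _) => {IH s}.
elim: s' bs' => [|y s IH] /=.
  by rewrite /comb !big_nil rmorph0 mulr0 add0r !big1 // => i _; rewrite big_nil rmorph0 mulr0.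
case/andP => bY /IH {}IH.
under eq_bigr do rewrite comb_cons rmorphD mulrDr.
under [in RHS]eq_bigr do rewrite comb_cons rmorphD mulrDr.
rewrite !big_split /= IH comb_cons rmorphD mulrDr addrACA; congr (_ + _) => {IH s}.
under eq_bigr do rewrite rmorphM mulrACA.
under [in RHS]eq_bigr do rewrite rmorphM mulrACA.
by rewrite -!mulr_sumr gram // rmorphM /= /hdot; ring.
Qed.

(** Half a basis vector lies in the open unit ball; a whole one does not. *)
Let eps : K := 2^-1.
Let E (i : 'I_n) : V := eps *: delta_mx 0 i.

Let eps0 : eps != 0.
Proof. by rewrite invr_eq0 pnatr_eq0. Qed.

Let E_ball i : hnorm2 (E i) < 1.
Proof.
have -> : hnorm2 (E i) = eps * eps^*.
  rewrite hnorm2Z /hnorm2 /hdot (bigD1 i) //= big1 => [|k ki]; last first.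
    by rewrite mxE (negPf ki) andbF mul0r.
  by rewrite mxE !eqxx mulr1n rmorph1; ring.
rewrite /eps fmorphV /= conjC_nat.
by rewrite -invfM invf_lt1 ?mulr_gt0 ?ltr0n // -natrM ltr1n.
Qed.

Let basis_comb (z : V) : seq (K * V) := [seq (eps^-1 * z 0 i, E i) | i <- enum 'I_n].
Let basis_ball z : all in_ballb (basis_comb z).
Proof. by apply/allP => x /mapP [i _ ->]; apply: E_ball. Qed.
Let comb_basis g z : comb g (basis_comb z) = linear_form (fun i => eps^-1 * g (E i)) z.
Proof.
rewrite /comb big_map big_enum /=; apply: eq_bigr => i _ /=; ring.
Qed.
Let coord_basis i z : comb (fun z => z 0 i) (basis_comb z) = z 0 i.
Proof.
rewrite comb_basis /linear_form (bigD1 i) //= big1 => [|k ki]; last first.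
  by rewrite !mxE [i == k]eq_sym (negPf ki) andbF !mulr0 mul0r.
by rewrite !mxE !eqxx /= mulr1 mulVf // mul1r addr0.
Qed.

(** The linear form that agrees with h at the points [E i]. On the ball, h differs from it somewhere
    exactly when the vectors (h z, z) span the whole space of dimension n + 1. *)
Let L := linear_form (fun i => eps^-1 * h (E i)).

Let diff (z : V) := (1, z) :: scale_comb (-1) (basis_comb z).
Let diff_ball z : hnorm2 z < 1 -> all in_ballb (diff z).
Proof. by move=> bz; rewrite /= all_scale basis_ball andbT. Qed.
Let comb_diff g z : comb g (diff z) = g z - comb g (basis_comb z).
Proof. by rewrite comb_cons comb_scale mul1r mulN1r. Qed.

Let comb_eq0 s : all in_ballb s -> comb h s = 0 ->
  (forall i, comb (fun z => z 0 i) s = 0) -> forall j, comb (f j) s = 0.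
Proof.
move=> bs h0 c0 j; have := comb_gram bs bs; rewrite h0 mul0r add0r.
rewrite [RHS]big1 => [|i _]; last by rewrite c0 mul0r.
move=> /eqP; rewrite psumr_eq0 => [/allP H|i _]; last exact: mul_conjC_ge0.
by have := H j (mem_index_enum _); rewrite /= mul_conjC_eq0 => /eqP.
Qed.

(** By the Gram identity, sending (h z, z) to f z preserves Hermitian products, so it extends to a
    linear isometry of the span. If the span is the graph of [L], f is linear; otherwise it is the
    whole space, and [al] and [be] are the images of (1, 0) and of the vectors (0, z). *)
Lemma gram_split :
  (exists g : 'I_m -> 'I_n -> K, forall z, hnorm2 z < 1 -> forall j, f j z = linear_form (g j) z) \/
  (exists (al : 'I_m -> K) (be : 'I_m -> 'I_n -> K),
    [/\ \sum_j al j * (al j)^* = 1,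
        forall z, \sum_j linear_form (be j) z * (al j)^* = 0,
        forall z, \sum_j linear_form (be j) z * (linear_form (be j) z)^* = hnorm2 z &
        forall z, hnorm2 z < 1 -> forall j, f j z = al j * h z + linear_form (be j) z]).
Proof.
have diff_coord z i : comb (fun z => z 0 i) (diff z) = 0.
  by rewrite comb_diff coord_basis subrr.
have [[w [bw hw]]|hL] := Classical_Prop.classic (exists w, hnorm2 w < 1 /\ h w != L w).
  right; pose de := h w - L w.
  have de0 : de != 0 by rewrite subr_eq0.
  (* [diff w] has all coordinates 0 and h-value [de], so [sal] represents (1, 0) and [sbe z]
     represents (0, z). *)
  pose sal := scale_comb de^-1 (diff w).
  pose sbe z := scale_comb (- L z) sal ++ basis_comb z.
  have bal : all in_ballb sal by rewrite all_scale diff_ball.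
  have bbe z : all in_ballb (sbe z) by rewrite all_cat all_scale bal basis_ball.
  have hal : comb h sal = 1 by rewrite comb_scale comb_diff comb_basis mulVf.
  have cal i : comb (fun z => z 0 i) sal = 0 by rewrite comb_scale diff_coord mulr0.
  have hbe z : comb h (sbe z) = 0.
    by rewrite comb_cat comb_scale hal comb_basis mulr1 addNr.
  have cbe z i : comb (fun z => z 0 i) (sbe z) = z 0 i.
    by rewrite comb_cat comb_scale cal mulr0 add0r coord_basis.
  pose al j := comb (f j) sal.
  pose be j i := eps^-1 * f j (E i) - al j * (eps^-1 * h (E i)).
  have beE j z : linear_form (be j) z = comb (f j) (sbe z).
    rewrite comb_cat comb_scale comb_basis -/(al j) /L /linear_form mulNr mulr_suml.
    rewrite addrC -sumrB; apply: eq_bigr => i _; rewrite /be; ring.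
  exists al, be; split=> [|z|z|z bz j].
  - rewrite comb_gram // hal rmorph1 mulr1 big1 ?addr0 // => i _.
    by rewrite cal mul0r.
  - under eq_bigr do rewrite beE.
    rewrite comb_gram // hbe mul0r add0r big1 // => i _.
    by rewrite cal rmorph0 mulr0.
  - under eq_bigr do rewrite beE.
    rewrite comb_gram // hbe mul0r add0r /hnorm2 /hdot.
    by apply: eq_bigr => i _; rewrite cbe.
  (* This combination represents (h z, z) - h z (1, 0) - (0, z) = 0, so every f_j vanishes on it. *)
  - pose s := (1, z) :: (scale_comb (- h z) sal ++ scale_comb (-1) (sbe z)).
    have bs : all in_ballb s.
      apply/andP; split; first exact: bz.
      suff: all in_ballb (scale_comb (- h z) sal ++ scale_comb (-1) (sbe z)) by [].
      by rewrite all_cat; apply/andP; split; rewrite all_scale.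
    have cE g : comb g s = g z - h z * comb g sal - comb g (sbe z).
      by rewrite comb_cons comb_cat !comb_scale /=; ring.
    have s0 : forall j, comb (f j) s = 0.
      apply: comb_eq0 => // [|i].
        by rewrite cE hal hbe; ring.
      by rewrite cE cal cbe; ring.
    have := s0 j; rewrite cE -beE -/(al j) => /eqP; rewrite subr_eq0 => /eqP <-; ring.
left; exists (fun j i => eps^-1 * f j (E i)) => z bz j.
have hz : h z = L z.
  by apply/eqP; apply: contraT => hne; case: hL; exists z.
have := comb_eq0 (diff_ball bz) _ (diff_coord z) j.
rewrite !comb_diff !comb_basis hz subrr => /(_ erefl) /eqP.
by rewrite subr_eq0 => /eqP.
Qed.
End Split.

(** The factor r^2 conj(s^2) is the same as in [hermitian_quotient2], so a single factor clears all
    denominators of the norm identity. *)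
Lemma hermitian_quotient (K : numClosedFieldType) (x y r s : K) : r != 0 -> s != 0 ->
  (r * x) * (s * y)^* = r * r * (s * s)^* * (x / r * (y / s)^*).
Proof.
move=> r0 s0; have sc0 : s^* != 0 by rewrite conjC_eq0.
by rewrite !rmorphM fmorphV /=; field; rewrite r0 sc0.
Qed.

Lemma hermitian_quotient2 (K : numClosedFieldType) (x y r s : K) : r != 0 -> s != 0 ->
  x * y^* = r * r * (s * s)^* * (x / (r * r) * (y / (s * s))^*).
Proof.
move=> r0 s0; have sc0 : s^* != 0 by rewrite conjC_eq0.
by rewrite [(y / _)^*]rmorphM fmorphV rmorphM /=; field; rewrite r0 sc0.
Qed.

(** * The dichotomy between linear and quadratic maps *)

Section Main.
Variables (K : numClosedFieldType) (n m : nat).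
Notation V := 'rV[K]_n.
Variables (P : 'I_m -> V -> K) (R : V -> K) (i0 i1 : 'I_n) (k : nat).
Hypotheses (PL : forall j, line_poly (P j)) (RL : line_poly R) (i01 : i0 != i1).
Hypothesis R0 : forall z, hnorm2 z < 1 -> R z != 0.
Hypothesis P0 : forall j, P j 0 = 0.
Let F j z := P j z / R z.
Let h z := 2^-1 * \sum_j F j z ^+ 2.
Hypothesis k0 : (0 < k)%N.
Hypothesis norm_eq : forall z, hnorm2 z < 1 ->
  1 - \sum_j F j z * (F j z)^* + h z * (h z)^* = (1 - hnorm2 z) ^+ k.

Let H z := 2^-1 * \sum_j P j z ^+ 2.
Let HL : line_poly H.
Proof.
apply: line_polyM; first exact: line_poly_cst.
by apply: line_poly_sum => j; apply: line_polyM.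
Qed.
Let RR z := R z * R z.
Let RRL : line_poly RR. Proof. exact: line_polyM. Qed.

Let hE z : hnorm2 z < 1 -> h z = H z / RR z.
Proof.
move=> bz; rewrite /h /H -mulrA mulr_suml; congr (_ * _); apply: eq_bigr => j _.
by rewrite /F /RR; have := R0 bz; move=> r0; field.
Qed.

(** Multiplied by R(z)^2 conj(R(w))^2, the norm identity is polynomial on lines, so [polarization]
    extends it from the diagonal of the ball to all pairs. In [Psi] the second argument plays the
    conjugate of w. *)
Let polarized z w : \sum_j (R z * P j z) * (R w * P j w)^* =
  H z * (H w)^* + RR z * (RR w)^* * (1 - (1 - hdot z w) ^+ k).
Proof.
pose Psi (z w : V) : K := \sum_j (R z * P j z) * ((R (conjv w) * P j (conjv w))^*)
  - (H z * (H (conjv w))^*) - (RR z * (RR (conjv w))^*) * (1 - (1 - \sum_i z 0 i * w 0 i) ^+ k).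
suff Psi0 : forall z w, Psi z w = 0.
  have := Psi0 z (conjv w); rewrite /Psi conjvK => /eqP; rewrite -addrA -opprD subr_eq0.
  by move/eqP->; congr (_ + _ * (1 - (1 - _) ^+ _)); apply: eq_bigr => i _; rewrite !mxE.
apply: polarization => [|u bu].
  apply: bilineB; first apply: bilineB.
  - apply: biline_sum => j; apply: bilineM; first by apply: biline_l; apply: line_polyM.
    by apply: biline_r; apply: (line_poly_conj (f := fun w => R w * P j w)); apply: line_polyM.
  - by apply: bilineM; [apply: biline_l | apply: biline_r; apply: line_poly_conj].
  - apply: bilineM.
      by apply: bilineM; [apply: biline_l | apply: biline_r; apply: line_poly_conj].
    apply: bilineB; first by apply: biline_l; apply: line_poly_cst.
    apply: bilineX; apply: bilineB; first by apply: biline_l; apply: line_poly_cst.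
    apply: biline_sum => i; apply: bilineM.
      by apply: biline_l; apply: line_poly_coord.
    by apply: biline_r; apply: line_poly_coord.
have -> : Psi u (conjv u) = RR u * (RR u)^* *
  (\sum_j F j u * (F j u)^* - h u * (h u)^* - (1 - (1 - hnorm2 u) ^+ k)).
  rewrite /Psi conjvK [RHS]mulrBr [X in _ = X - _]mulrBr mulr_sumr hE //.
  congr (_ - _ - _).
  - by apply: eq_bigr => j _; apply: hermitian_quotient; apply: R0.
  - by apply: hermitian_quotient2; apply: R0.
  - congr (_ * (1 - (1 - _) ^+ _)).
    by apply: eq_bigr => i _; rewrite !mxE.
by rewrite -norm_eq //; ring.
Qed.

Let zero_in_ball : hnorm2 (0 : V) < 1. Proof. by rewrite hnorm2_0. Qed.

Let k1 : k = 1%N.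
Proof.
apply/eqP; rewrite eqn_leq k0 andbT.
pose e (a : bool) : V := delta_mx 0 (if a then i0 else i1).
have edot a b t u : hdot (0 + t *: e a) (0 + u *: e b) = (a == b)%:R * t * u^*.
  rewrite /hdot (bigD1 (if a then i0 else i1)) //= big1 => [|i ia]; last first.
    by rewrite !mxE (negPf ia) andbF mulr0 addr0 mul0r.
  rewrite !add0r addr0 !mxE !eqxx /= mulr1 rmorphM /= rmorph_nat.
  have -> : ((if a then i0 else i1) == (if b then i0 else i1)) = (a == b).
    by case: a b => [] [] //=; rewrite ?eqxx ?(negPf i01) // eq_sym (negPf i01).
  by ring.
have PRL j : line_poly (fun z => R z * P j z) by apply: line_polyM.
have [p Hp] : exists p : bool -> 'I_m -> {poly K}, forall a j t,
    R (0 + t *: e a) * P j (0 + t *: e a) = (p a j).[t].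
  exact: (fin_all_exists (fun a => fin_all_exists (fun j => PRL j 0 (e a)))).
have [q Hq] := fin_all_exists (fun a => HL 0 (e a)).
have [s Hs] := fin_all_exists (fun a => RRL 0 (e a)).
apply: (@gram_exponent_le1 _ _ p q s k) => [a|a b t u].
  by rewrite -horner_coef0 -Hs scale0r addr0 /RR mulf_neq0 ?R0.
under eq_bigr do rewrite -!Hp.
by rewrite polarized -!Hq -!Hs edot.
Qed.

Let gram z w : hnorm2 z < 1 -> hnorm2 w < 1 ->
  \sum_j F j z * (F j w)^* = h z * (h w)^* + hdot z w.
Proof.
move=> bz bw; have := polarized z w; rewrite k1 expr1 opprB addrCA subrr addr0 => E.
apply: (mulfI (x := RR z * (RR w)^*)).
  by rewrite mulf_neq0 // ?conjC_eq0 mulf_neq0 ?R0.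
transitivity (\sum_j (R z * P j z) * (R w * P j w)^*).
  by rewrite mulr_sumr; apply: eq_bigr => j _; rewrite hermitian_quotient ?R0.
by rewrite E !hE // mulrDr -hermitian_quotient2 ?R0.
Qed.

Let scaled_ball (z : V) t : hnorm2 z < 1 -> 0 < t < 1 -> hnorm2 (0 + t *: z) < 1.
Proof.
move=> bz /andP [t0 t1]; rewrite add0r hnorm2Z (CrealP (gtr0_real t0)).
apply: le_lt_trans bz; by rewrite ler_piMl ?hnorm2_ge0 // mulr_ile1 ?ltW.
Qed.

Definition line_poly_deg d (g : V -> K) :=
  forall a b : V, exists2 q : {poly K}, (size q <= d.+1)%N & forall t, g (a + t *: b) = q.[t].

(** The last clause detects the degree: numerators and denominator of degree at most one on lines
    are possible only if h = 0, and then F is [be]. *)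
Lemma linear_or_quadratic :
  (exists g, forall z : V, hnorm2 z < 1 -> forall j, F j z = linear_form (g j) z) \/
  (exists (al : 'I_m -> K) (be : 'I_m -> 'I_n -> K),
    let B (z : V) := \sum_j al j * linear_form (be j) z in
    let Q (z : V) := \sum_j linear_form (be j) z ^+ 2 in
    [/\ forall z : V, hnorm2 z < 1 -> B z != 1,
        forall z : V, hnorm2 z < 1 -> forall j,
          F j z = al j * (Q z / (2 * (1 - B z))) + linear_form (be j) z &
        forall (P' : 'I_m -> V -> K) (R' : V -> K),
          (forall j, line_poly_deg 1 (P' j)) -> line_poly_deg 1 R' ->
          (forall z : V, hnorm2 z < 1 -> R' z != 0) ->
          (forall z : V, hnorm2 z < 1 -> forall j, F j z = P' j z / R' z) ->
          forall z : V, hnorm2 z < 1 -> forall j, F j z = linear_form (be j) z]).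
Proof.
have [|[al [be [alal beal bebe FE]]]] := gram_split gram; first by left.
pose A := \sum_j al j ^+ 2.
pose B (z : V) := \sum_j al j * linear_form (be j) z.
pose Q (z : V) := \sum_j linear_form (be j) z ^+ 2.
have BZ t z : B (t *: z) = t * B z.
  by rewrite /B mulr_sumr; apply: eq_bigr => j _; rewrite linear_formZ mulrCA.
have QZ t z : Q (t *: z) = t ^+ 2 * Q z.
  by rewrite /Q mulr_sumr; apply: eq_bigr => j _; rewrite linear_formZ exprMn.
have quad z : hnorm2 z < 1 -> 2 * h z = A * h z ^+ 2 + 2 * B z * h z + Q z.
  move=> bz; rewrite {1}/h mulrA divff ?pnatr_eq0 // mul1r.
  rewrite /A /B /Q !(mulr_sumr, mulr_suml) -!big_split /=; apply: eq_bigr => j _.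
  by rewrite FE //; ring.
(* If B z = 1, then |al - conj(be z)|^2 = 1 + |z|^2 - 2 Re(B z) would equal |z|^2 - 1 < 0. *)
have B1 z : hnorm2 z < 1 -> B z != 1.
  move=> bz; apply/eqP => Bz1.
  have : 0 <= \sum_j (al j - (linear_form (be j) z)^*) * (al j - (linear_form (be j) z)^*)^*.
    by apply: sumr_ge0 => j _; apply: mul_conjC_ge0.
  have -> : \sum_j (al j - (linear_form (be j) z)^*) * (al j - (linear_form (be j) z)^*)^*
     = \sum_j al j * (al j)^* + \sum_j linear_form (be j) z * (linear_form (be j) z)^*
       - B z - (B z)^*.
    rewrite /B rmorph_sum -big_split /= -sumrB -sumrB; apply: eq_bigr => j _.
    by rewrite rmorphB rmorphM /= conjCK; ring.
  rewrite alal bebe Bz1 rmorph1 => le0.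
  have : 0 <= hnorm2 z - 1 by rewrite (le_trans le0) // le_eqVlt; apply/orP; left; apply/eqP; ring.
  by rewrite subr_ge0 => /(lt_le_trans bz); rewrite ltxx.
have line z : hnorm2 z < 1 -> exists q s : {poly K},
   [/\ q.[0] = 0, s.[0] != 0, h z = q.[1] / s.[1] &
       forall t, 0 < t < 1 -> s.[t] != 0 /\ h (0 + t *: z) = q.[t] / s.[t]].
  move=> bz; have [q Hq] := HL 0 z; have [s Hs] := RRL 0 z; exists q, s; split.
  - by rewrite -Hq scale0r addr0 /H big1 ?mulr0 // => j _; rewrite P0 expr0n.
  - by rewrite -Hs scale0r addr0 mulf_neq0 ?R0.
  - by rewrite -Hq -Hs scale1r add0r hE.
  - move=> t t01; have bt := scaled_ball bz t01.
    by rewrite -Hs -Hq -hE //; split=> //; rewrite mulf_neq0 ?R0.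
have [A0|A0] := eqVneq A 0.
  right; exists al, be => B' Q'; have hQ z : hnorm2 z < 1 -> h z = Q z / (2 * (1 - B z)).
    move=> bz; have d0 : 1 - B z != 0 by rewrite subr_eq0 eq_sym B1.
    have := quad z bz; rewrite A0 mul0r add0r => E.
    have -> : Q z = 2 * (1 - B z) * h z by rewrite -[Q z](addKr (2 * B z * h z)) -E; ring.
    by field; rewrite d0.
  split=> [//|z bz j|P' R' PL' RL' R0' FE' z bz j].
    by rewrite FE // hQ.
  rewrite FE // hQ //.
  suff -> : Q z = 0 by rewrite mul0r mulr0 add0r.
  have [r sr Hr] := RL' 0 z.
  have [p Hps Hp] := fin_all_exists2 (fun j => PL' j 0 z).
  (* As [be] is orthogonal to [al], h is the product of F with [al]. On the line its numerator is
     [w], of degree at most 1 and zero at 0, hence a multiple of X; but h = Q t^2 / (2 (1 - B t))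
     has no term of order one, so Q = 0. *)
  pose w := \sum_j (al j)^* *: p j.
  have hal u : hnorm2 u < 1 -> h u = \sum_j (al j)^* * F j u.
    move=> bu; transitivity (h u * (\sum_j al j * (al j)^*) +
       \sum_j linear_form (be j) u * (al j)^*); first by rewrite alal beal mulr1 addr0.
    by rewrite mulr_sumr -big_split /=; apply: eq_bigr => i _; rewrite FE //; ring.
  have r0 : r.[0] != 0 by rewrite -Hr scale0r addr0 R0'.
  have w0 : w`_0 = 0.
    rewrite -horner_coef0 horner_sum big1 // => i _; rewrite hornerZ -Hp scale0r addr0.
    have := FE' 0 zero_in_ball i; rewrite /F P0 mul0r => /esym/eqP.
    by rewrite mulf_eq0 invr_eq0 (negPf (R0' _ zero_in_ball)) orbF => /eqP ->; rewrite mulr0.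
  have wE : w = w`_1 *: 'X.
    apply/polyP => -[|[|i]]; rewrite coefZ coefX ?w0 ?mulr0 ?mulr1 //= nth_default //.
    apply: leq_trans (size_sum _ _ _) _; apply/bigmax_leqP => i' _.
    by apply: leq_trans (size_scale_leq _ _) _; apply: leq_trans (Hps i') _.
  have E : w * (2 *: (1 - B z *: 'X)) = Q z *: ('X ^+ 2 * r).
    apply/eqP; rewrite -subr_eq0; apply/eqP.
    apply: (poly_eq0_small ltr01) => t t01; have bt := scaled_ball bz t01.
    have rt : r.[t] != 0 by rewrite -Hr R0'.
    have d0 : 1 - t * B z != 0 by rewrite -BZ -[t *: z]add0r subr_eq0 eq_sym B1.
    have wt : w.[t] / r.[t] = h (0 + t *: z).
      rewrite hal // horner_sum mulr_suml; apply: eq_bigr => i _.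
      by rewrite FE' // hornerZ Hp Hr mulrA.
    move: wt; rewrite hQ // add0r BZ QZ => wt.
    have -> : (w * (2 *: (1 - B z *: 'X)) - Q z *: ('X ^+ 2 * r)).[t] =
      r.[t] * 2 * (1 - t * B z) * (w.[t] / r.[t] - t ^+ 2 * Q z / (2 * (1 - t * B z))).
      by rewrite hornerD hornerN hornerM !hornerZ hornerM hornerXn hornerD hornerN hornerZ hornerX hornerC; field; rewrite d0 rt.
    by rewrite wt subrr mulr0.
  have E1 : w`_1 *: (2 *: (1 - B z *: 'X)) = Q z *: ('X * r).
    apply: (mulfI (x := 'X)); first by rewrite polyX_eq0.
    transitivity (Q z *: ('X ^+ 2 * r)); last by rewrite -!mul_polyC; ring.
    by rewrite -E [in RHS]wE -!mul_polyC; ring.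
  have w10 : w`_1 = 0.
    have /(congr1 (fun u => u.[0])) := E1; rewrite !hornerZ hornerD hornerN hornerZ hornerM hornerX hornerC mul0r !mulr0 subr0 mulr1 => /eqP.
    by rewrite mulf_eq0 pnatr_eq0 /= orbF => /eqP.
  move: E1; rewrite w10 scale0r => /esym/eqP; rewrite scaler_eq0 mulf_eq0 polyX_eq0 /=.
  case/orP => [/eqP //|/eqP rz]; by move: r0; rewrite rz horner0 eqxx.
left; exists be => z bz j.
suff h0 : h z = 0 by rewrite FE // h0 mulr0 add0r.
have [q [s [q0 s0 -> Hqs]]] := line z bz.
suff -> : q = 0 by rewrite horner0 mul0r.
have sn0 : s != 0 by apply: contraNneq s0 => ->; rewrite horner0.
have E : A *: q ^+ 2 - 2 *: ((1 - B z *: 'X) * q * s) + Q z *: ('X ^+ 2 * s ^+ 2) = 0.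
  apply: (poly_eq0_small ltr01) => t t01; have [st ht] := Hqs t t01.
  have := quad _ (scaled_ball bz t01); rewrite ht add0r BZ QZ => E.
  have : s.[t] ^+ 2 * (A * (q.[t] / s.[t]) ^+ 2 + 2 * (t * B z) * (q.[t] / s.[t]) + t ^+ 2 * Q z
      - 2 * (q.[t] / s.[t])) = 0 by rewrite -E subrr mulr0.
  by move=> <-; rewrite hornerD hornerD hornerN !hornerZ !hornerM hornerD hornerN hornerZ !hornerX hornerC; field.
have Q0 := discriminant_square E A0 sn0.
move: E; rewrite Q0 scale0r addr0 => /eqP.
(* The second factor takes the value -2 s(0) at 0, because q(0) = 0; it is therefore nonzero and q =
   0. *)
have -> : A *: q ^+ 2 - 2 *: ((1 - B z *: 'X) * q * s) = q * (A *: q - 2 *: ((1 - B z *: 'X) * s)).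
  by rewrite -!mul_polyC; ring.
rewrite mulf_eq0 => /orP [/eqP //|/eqP /(congr1 (fun u => u.[0]))].
rewrite hornerD hornerN !hornerZ hornerM q0 hornerD hornerN hornerZ hornerX hornerC horner0.
by move=> /eqP; rewrite !mulr0 subr0 mul1r add0r oppr_eq0 mulf_eq0 pnatr_eq0 /= (negPf s0).
Qed.
End Main.

Local Notation RR := Rdefinitions.R.
Local Notation K := (complex RR).
Local Notation toK := (real_complex RR).

(** * Levi forms of logarithms of real polynomials *)

(** The real part makes real differentiation apply to polynomials with complex coefficients; by
    [horner_real] it loses nothing when the coefficients are real. *)
Definition re_horner (p : {poly K}) (t : RR) : RR := complex.Re (p.[toK t]).

Section Analytic.
Local Open Scope R_scope.

Lemma derivable_pt_lim_local (f g : RR -> RR) x l d : 0 < d ->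
  (forall y, Rabs (y - x) < d -> f y = g y) ->
  derivable_pt_lim f x l -> derivable_pt_lim g x l.
Proof.
move=> d0 E H eps e0; have [de Hde] := H eps e0.
have m0 : 0 < Rmin d de by apply: Rmin_pos => //; apply: cond_pos.
exists (mkposreal _ m0) => h h0 /= hm.
rewrite -!E; first by apply: Hde => //; apply: Rlt_le_trans hm (Rmin_r _ _).
  by rewrite Rminus_diag Rabs_R0.
by replace (x + h - x) with h by lra; apply: Rlt_le_trans hm (Rmin_l _ _).
Qed.

(** Makes the second derivatives supplied by the isometry comparable with those computed from
    polynomials. Agreement near 0 is the right hypothesis, since F is given by polynomials only
    inside the ball. *)
Lemma second_deriv0_unique (f g : RR -> RR) l l' d : 0 < d ->
  (forall t, Rabs t < d -> f t = g t) ->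
  second_deriv0 f l -> second_deriv0 g l' -> l = l'.
Proof.
move=> d0 E [f1 [d1 [d10 [H1 H2]]]] [g1 [d2 [d20 [H3 H4]]]].
pose e := Rmin d (Rmin d1 d2).
have e0 : 0 < e by apply: Rmin_pos => //; apply: Rmin_pos.
have ed : e <= d by apply: Rmin_l.
have ed1 : e <= d1 by apply: Rle_trans (Rmin_r _ _) (Rmin_l _ _).
have ed2 : e <= d2 by apply: Rle_trans (Rmin_r _ _) (Rmin_r _ _).
have Efg t : Rabs t < e -> f1 t = g1 t.
  move=> te; apply: (uniqueness_limite g t); last by apply: H3; lra.
  apply: (@derivable_pt_lim_local f g t _ (e - Rabs t)); first by lra.
    move=> y hy; apply: E.
    have := Rabs_triang (y - t) t; replace (y - t + t) with y by lra; lra.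
  by apply: H1; lra.
apply: (uniqueness_limite g1 0) => //.
apply: (@derivable_pt_lim_local f1 g1 0 _ e) => // y hy; apply: Efg.
by rewrite Rminus_0_r in hy.
Qed.

Lemma second_deriv0_lin c1 c2 f g l1 l2 : second_deriv0 f l1 -> second_deriv0 g l2 ->
  second_deriv0 (fun t => c1 * f t + c2 * g t) (c1 * l1 + c2 * l2).
Proof.
move=> [f1 [d1 [d10 [H1 H2]]]] [g1 [d2 [d20 [H3 H4]]]].
have lin u v x a b : derivable_pt_lim u x a -> derivable_pt_lim v x b ->
    derivable_pt_lim (fun t => c1 * u t + c2 * v t) x (c1 * a + c2 * b).
  move=> Hu Hv; apply: (derivable_pt_lim_plus (mult_real_fct c1 u) (mult_real_fct c2 v)).
    exact: derivable_pt_lim_scal.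
  exact: derivable_pt_lim_scal.
exists (fun t => c1 * f1 t + c2 * g1 t), (Rmin d1 d2); split; first exact: Rmin_pos.
split; last exact: lin.
move=> t ht; apply: lin.
  by apply: H1; apply: Rlt_le_trans ht (Rmin_l _ _).
by apply: H3; apply: Rlt_le_trans ht (Rmin_r _ _).
Qed.

Lemma derivable_re_horner p t : derivable_pt_lim (re_horner p) t (re_horner (p^`())%R t).
Proof.
elim/poly_ind: p t => [|p c IH] t.
  apply: (derivable_pt_lim_ext (fun _ => 0)); first by move=> x; rewrite /re_horner horner0.
  by rewrite deriv0 /re_horner horner0; apply: derivable_pt_lim_const.
have E x : re_horner p x * x + complex.Re c = re_horner (p * 'X + c%:P)%R x.
  rewrite /re_horner hornerMXaddC; case: (p.[_])%R => a b; case: c => c d /=.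
  by change (a * x + c = a * x - b * 0 + c); lra.
apply: (derivable_pt_lim_ext _ _ _ _ E).
rewrite derivD derivM derivX derivC mulr1 addr0.
have -> : re_horner (p^`() * 'X + p)%R t = (re_horner (p^`())%R t * t + re_horner p t * 1) + 0.
  rewrite /re_horner hornerD hornerMX; case: (p^`().[_])%R => a b; case: (p.[_])%R => e f /=.
  by change (a * t - b * 0 + e = a * t + e * 1 + 0); lra.
apply: (derivable_pt_lim_plus (fun x => re_horner p x * x) (fun _ => complex.Re c)).
  by apply: (derivable_pt_lim_mult (re_horner p) id) => //; apply: derivable_pt_lim_id.
exact: derivable_pt_lim_const.
Qed.

Lemma second_deriv0_ln_re_horner p d : 0 < d ->
  (forall t, Rabs t < d -> 0 < re_horner p t) ->
  second_deriv0 (fun t => ln (re_horner p t))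
   ((re_horner (p^`()^`())%R 0 * re_horner p 0 - re_horner (p^`())%R 0 * re_horner (p^`())%R 0)
     / (re_horner p 0 * re_horner p 0)).
Proof.
move=> d0 H; exists (fun t => re_horner (p^`())%R t / re_horner p t), d; split=> //; split.
  move=> t td; rewrite /Rdiv Rmult_comm.
  apply: (derivable_pt_lim_comp (re_horner p) ln); first exact: derivable_re_horner.
  by apply: derivable_pt_lim_ln; apply: H.
have := derivable_pt_lim_div (re_horner (p^`())%R) (re_horner p) 0 _ _
  (derivable_re_horner _ _) (derivable_re_horner _ _).
rewrite /Rsqr; apply; have := H 0; rewrite Rabs_R0; lra.
Qed.
End Analytic.

Section Along.
Variable F : comNzRingType.
Implicit Types (u : {poly {poly F}}).

(** Restriction of u to the line (a + c X, b + d X). With b the conjugate of a, the directions (1,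
    1) and (['i], [- 'i]) follow the real and imaginary axes through a. *)
Definition along u (a c b d : F) : {poly F} :=
  (map_poly (comp_poly (b%:P + d *: 'X)) u).[a%:P + c *: 'X].

Lemma horner_along u a c b d t : (along u a c b d).[t] = u.[(a + c * t)%:P].[b + d * t].
Proof.
elim/poly_ind: u => [|u p IH]; first by rewrite /along rmorph0 !horner0.
rewrite /along rmorphD rmorphM /= map_polyX map_polyC /= !hornerMXaddC.
by rewrite !hornerD hornerM IH horner_comp !hornerM !hornerE.
Qed.

Lemma deriv_in_MXaddC u p : deriv_in (u * 'X + p%:P) = deriv_in u * 'X + (p^`())%:P.
Proof.
rewrite /deriv_in rmorphD rmorphM /= swapXY_X swapXY_polyC derivD derivM derivC mulr0 addr0.
by rewrite rmorphD rmorphM /= swapXY_Y deriv_map swapXY_map_polyC.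
Qed.

Lemma deriv_along u a c b d :
  (along u a c b d)^`() = c *: along u^`() a c b d + d *: along (deriv_in u) a c b d.
Proof.
elim/poly_ind: u => [|u p IH].
  by rewrite /deriv_in deriv0 !rmorph0 deriv0 rmorph0 /along !rmorph0 !horner0 deriv0 !scaler0 addr0.
have alD v w : along (v + w) a c b d = along v a c b d + along w a c b d.
  by rewrite /along rmorphD hornerD.
have alM v : along (v * 'X) a c b d = along v a c b d * (a%:P + c *: 'X).
  by rewrite /along rmorphM /= map_polyX hornerMX.
have alC q : along q%:P a c b d = q \Po (b%:P + d *: 'X).
  by rewrite /along map_polyC hornerC.
rewrite deriv_in_MXaddC derivD derivM derivX derivC mulr1 addr0 !alD !alM !alC.
rewrite derivD derivM IH derivD derivC derivZ derivX deriv_comp derivD derivC derivZ derivX.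
by rewrite -!mul_polyC; ring.
Qed.

Lemma deriv_inC u : (deriv_in u)^`() = deriv_in u^`().
Proof.
apply/polyP => i; apply/polyP => j.
rewrite /deriv_in coef_deriv coefMn !coef_swapXY !coef_deriv !coefMn !coef_swapXY.
by rewrite coef_deriv coefMn mulrnAC.
Qed.
Lemma horner2_combination u v w c t s :
  (u ^+ 2 * v + c%:P%:P * w ^+ 2).[t%:P].[s] =
  u.[t%:P].[s] ^+ 2 * v.[t%:P].[s] + c * w.[t%:P].[s] ^+ 2.
Proof. by rewrite !expr2 !hornerD !hornerM !hornerC. Qed.
End Along.

Lemma pos_toK (x : K) : 0 < x -> x = toK (complex.Re x) /\ Rlt 0 (complex.Re x).
Proof.
by case: x => a b; rewrite ltcE /= => /andP [/eqP -> /RltP]; split.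
Qed.

(** A polynomial and its conjugate agree at small positive reals, hence coincide. Real coefficients,
    unlike real values near 0, pass at once to the derivatives. *)
Lemma real_on_small_reals (p : {poly K}) d : Rlt 0 d ->
  (forall t, Rlt (Rabs t) d -> p.[toK t] \is Num.real) -> map_poly Num.conj p = p.
Proof.
move=> d0 H; apply/eqP; rewrite -subr_eq0; apply/eqP.
apply: (@poly_eq0_small _ _ (toK d)); first by rewrite ltcR; apply/RltP.
case=> a b /andP [+ +]; rewrite !ltcE /= => /andP [/eqP -> /RltP a0] /andP [_ /RltP ad].
have -> : Complex a 0 = toK a by [].
have ra : (toK a)^* = toK a by apply: CrealP; apply/complex_realP; exists a.
rewrite hornerD hornerN -{1}ra horner_map /= (CrealP _) ?subrr //.
by apply: H; rewrite Rabs_pos_eq //; apply: Rlt_le.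
Qed.

Lemma horner_real (p : {poly K}) t : map_poly Num.conj p = p -> p.[toK t] = toK (re_horner p t).
Proof.
move=> pR; have tR : (toK t)^* = toK t by apply: CrealP; apply/complex_realP; exists t.
have : p.[toK t] \is Num.real by apply/CrealP; rewrite -horner_map /= tR pR.
by move/complex_realP => [k E]; rewrite /re_horner E.
Qed.

Lemma second_deriv0_ext (f g : RR -> RR) l : f =1 g -> second_deriv0 f l -> second_deriv0 g l.
Proof.
move=> E [f1 [d [d0 [H1 H2]]]]; exists f1, d; split=> //; split=> // t td.
exact: derivable_pt_lim_ext E (H1 t td).
Qed.

Lemma toK_plus (a b : RR) : toK (Rplus a b) = toK a + toK b.
Proof. exact: (rmorphD toK). Qed.

Lemma toK_quotient (a b r : RR) :
  toK (Rdiv (Rminus (Rmult a r) (Rmult b b)) (Rmult r r)) =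
  (toK a * toK r - toK b * toK b) / (toK r * toK r).
Proof.
change (toK ((a * r - b * b) / (r * r)) = (toK a * toK r - toK b * toK b) / (toK r * toK r)).
by rewrite fmorph_div rmorphB !rmorphM.
Qed.

(** The Laplacian of log u(x, conj x) is four times the mixed derivative of log u; multiplying by
    u^2 removes the quotient. *)
Lemma levi_ln (u : {poly {poly K}}) (x : K) d : Rlt 0 d ->
  (forall t, Rlt (Rabs t) d -> 0 < u.[(x + toK t)%:P].[(x + toK t)^*]) ->
  (forall t, Rlt (Rabs t) d -> 0 < u.[(x + 'i * toK t)%:P].[(x + 'i * toK t)^*]) ->
  exists l1 l2 : RR,
  [/\ second_deriv0 (fun t => ln (complex.Re u.[(x + toK t)%:P].[(x + toK t)^*])) l1,
      second_deriv0 (fun t => ln (complex.Re u.[(x + 'i * toK t)%:P].[(x + 'i * toK t)^*])) l2 &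
      toK (Rplus l1 l2) * u.[x%:P].[x^*] ^+ 2 =
      4 * (log_hessian u).[x%:P].[x^*]].
Proof.
move=> d0 H1 H2.
have cR t : (toK t)^* = toK t by apply: CrealP; apply/complex_realP; exists t.
pose g1 := along u x 1 x^* 1; pose g2 := along u x 'i x^* (- 'i).
have E1 t : g1.[toK t] = u.[(x + toK t)%:P].[(x + toK t)^*].
  by rewrite horner_along !mul1r [(_ + _)^*]rmorphD /= cR.
have E2 t : g2.[toK t] = u.[(x + 'i * toK t)%:P].[(x + 'i * toK t)^*].
  by rewrite horner_along [(_ + _)^*]rmorphD rmorphM /= cR conjCi.
have gR (g : {poly K}) : (forall t, Rlt (Rabs t) d -> 0 < g.[toK t]) -> map_poly Num.conj g = g.
  by move=> H; apply: (real_on_small_reals d0) => t /H /gtr0_real.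
have P1 t : Rlt (Rabs t) d -> 0 < g1.[toK t] by rewrite E1; apply: H1.
have P2 t : Rlt (Rabs t) d -> 0 < g2.[toK t] by rewrite E2; apply: H2.
have G1 := gR _ P1; have G2 := gR _ P2.
have pos g t : 0 < g.[toK t] -> Rlt 0 (re_horner g t) by move=> /pos_toK [].
have S1 := second_deriv0_ln_re_horner d0 (fun t ht => pos _ _ (P1 t ht)).
have S2 := second_deriv0_ln_re_horner d0 (fun t ht => pos _ _ (P2 t ht)).
have gD (g : {poly K}) : map_poly Num.conj g = g -> map_poly Num.conj g^`() = g^`().
  by move=> h; rewrite -deriv_map h.
have D0 : Rlt (Rabs R0) d by rewrite Rabs_R0.
have r1 : toK (re_horner g1 R0) = u.[x%:P].[x^*].
  by rewrite -horner_real // E1 addr0.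
have r2 : toK (re_horner g2 R0) = u.[x%:P].[x^*].
  by rewrite -horner_real // E2 mulr0 addr0.
have u0 : u.[x%:P].[x^*] != 0 by rewrite -r1 -horner_real // lt0r_neq0 ?P1.
have h0 v c c' : (along v x c x^* c').[toK R0] = v.[x%:P].[x^*].
  by rewrite horner_along !mulr0 !addr0.
eexists; eexists; split.
- by apply: (second_deriv0_ext _ S1) => t; rewrite /re_horner E1.
- by apply: (second_deriv0_ext _ S2) => t; rewrite /re_horner E2.
rewrite toK_plus !toK_quotient r1 r2.
rewrite -!horner_real ?gD // /g1 /g2 !deriv_along !derivD !derivZ !deriv_along.
rewrite /log_hessian !(hornerD, hornerN, hornerM, hornerZ) !h0 deriv_inC.
have := sqrCi K; move: ('i : K) => w ww.
move: u0; move: (u.[x%:P].[x^*]) (u^`().[x%:P].[x^*]) ((deriv_in u).[x%:P].[x^*])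
  (u^`()^`().[x%:P].[x^*]) ((deriv_in u^`()).[x%:P].[x^*])
  ((deriv_in (deriv_in u)).[x%:P].[x^*]) => a b c A B D a0.
(* With a free w in place of ['i], the two sides differ by an explicit multiple of w^2 + 1. *)
transitivity (4 * (a * B - b * c) + (w ^+ 2 + 1) * ((A - 2 * B + D) * a - (b - c) ^+ 2)).
  by field.
by rewrite ww addNr mul0r addr0.
Qed.

(** * From the isometry condition to the norm identity *)

Definition c2k (c : Defs.C) : K := Complex c.1 c.2.
Definition k2c (x : K) : Defs.C := (complex.Re x, complex.Im x).

Lemma k2cK : cancel k2c c2k. Proof. by case. Qed.

Lemma c2k_inj : injective c2k. Proof. by case=> a b [c d] [-> ->]. Qed.
Lemma c2kD a b : c2k (Cadd a b) = c2k a + c2k b. Proof. by []. Qed.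
Lemma c2kM a b : c2k (Cmul a b) = c2k a * c2k b. Proof. by []. Qed.
Lemma c2k_RtoC t : c2k (RtoC t) = toK t. Proof. by []. Qed.
Lemma c2k_i : c2k Ci = 'i. Proof. by rewrite -complexiE. Qed.

(** Identifies the abstract conjugation of a closed field with the concrete one, through x x^* =
    |x|^2. *)
Lemma conjcE (x : K) : x^* = conjc x.
Proof.
have [->|x0] := eqVneq x 0; first by rewrite rmorph0 /= oppr0.
by apply: (mulfI x0); rewrite -normCK sqr_normc.
Qed.

Lemma toK_Cnorm2 a : toK (Cnorm2 a) = c2k a * (c2k a)^*.
Proof.
rewrite conjcE; case: a => a b; rewrite /Cnorm2 /c2k /=; apply/eqP; rewrite eq_complex /=.
by rewrite !mulrN opprK eqxx /= mulrC addNr.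
Qed.

Lemma c2k_div a b : c2k (Cdiv a b) = c2k a / c2k b.
Proof.
rewrite c2kM; congr (_ * _); case: b => b1 b2.
transitivity (Complex (b1 / (b1 * b1 + b2 * b2)) (- b2 / (b1 * b1 + b2 * b2))) => //.
by rewrite mulNr.
Qed.

Lemma c2k_pow a k : c2k (Cpow a k) = c2k a ^+ k.
Proof. by elim: k => [|k IH] //=; rewrite c2kM IH exprS. Qed.

Lemma fold_right_big (T : Type) (op : T -> T -> T) idx n (f : nat -> T) :
  List.fold_right (fun i acc => op (f i) acc) idx (List.seq 0 n) = \big[op/idx]_(i < n) f i.
Proof.
rewrite -(big_mkord xpredT f) /index_iota subn0 unlock.
by elim: n 0%N => [|n IH] k //=; rewrite IH.
Qed.

Lemma c2k_Csum n f : c2k (Csum n f) = \sum_(i < n) c2k (f i).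
Proof. by rewrite /Csum fold_right_big; apply: (big_morph c2k c2kD). Qed.

Lemma c2k_Cprod n f : c2k (Cprod n f) = \prod_(i < n) c2k (f i).
Proof. by rewrite /Cprod fold_right_big; apply: (big_morph c2k c2kM). Qed.

Lemma toK_Rsum n f : toK (Rsum n f) = \sum_(i < n) toK (f i).
Proof. by rewrite /Rsum fold_right_big; apply: (big_morph toK toK_plus). Qed.

Lemma nsumE n f : nsum n f = (\sum_(i < n) f i)%N.
Proof. exact: (fold_right_big addn). Qed.

Section Row.
Variable n : nat.
Notation V := 'rV[K]_n.

Definition row_of (z : cvec) : V := \row_i c2k (z i).
Definition cvec_of (x : V) : cvec := fun i => if insub i is Some j then k2c (x 0 j) else C0.

Lemma cvec_ofK x : row_of (cvec_of x) = x.
Proof. by apply/rowP => i; rewrite mxE /cvec_of valK k2cK. Qed.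

Lemma toK_norm2 z : toK (norm2 n z) = hnorm2 (row_of z).
Proof. by rewrite /norm2 toK_Rsum; apply: eq_bigr => i _; rewrite toK_Cnorm2 mxE. Qed.

Lemma in_ballP z : in_ball n z <-> hnorm2 (row_of z) < 1.
Proof.
rewrite -toK_norm2 -(rmorph1 toK) ltcR /in_ball.
by split=> /RltP.
Qed.

Lemma row_of_add z w : row_of (vadd z w) = row_of z + row_of w.
Proof. by apply/rowP => i; rewrite !mxE. Qed.

Lemma row_of_scale c w : row_of (vscale c w) = c2k c *: row_of w.
Proof. by apply/rowP => i; rewrite !mxE. Qed.

Lemma row_of_zero : row_of czero = 0.
Proof. by apply/rowP => i; rewrite !mxE. Qed.

Definition monomial (al : nat -> nat) (x : V) : K := \prod_(i < n) x 0 i ^+ al i.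
Definition mpeval (p : cpoly) (x : V) : K := \sum_(tm <- p) c2k tm.1 * monomial tm.2 x.

Lemma c2k_poly_eval p z : c2k (poly_eval n p z) = mpeval p (row_of z).
Proof.
rewrite /mpeval; elim: p => [|tm p IH]; first by rewrite big_nil.
rewrite big_cons /= c2kD c2kM IH /monom c2k_Cprod; congr (_ * _ + _).
by apply: eq_bigr => i _; rewrite c2k_pow mxE.
Qed.

Lemma monomial_line (al : nat -> nat) (a b : V) : exists2 q : {poly K},
  (size q <= (\sum_(i < n) al i).+1)%N & forall t, monomial al (a + t *: b) = q.[t].
Proof.
exists (\prod_(i < n) ((a 0 i)%:P + b 0 i *: 'X) ^+ al i) => [|t]; last first.
  rewrite horner_prod; apply: eq_bigr => i _.
  by rewrite horner_exp !mxE !hornerE mulrC.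
elim/big_ind2: _ => [|p d q e sp sq|i _].
- by rewrite size_poly1.
- apply: leq_trans (size_polyMleq _ _) _.
  by rewrite -subn1 leq_subLR (leq_trans (leq_add sp sq)) // addSn addnS add1n.
- elim: (al i) => [|k IH]; first by rewrite expr0 size_poly1.
  rewrite exprS; apply: leq_trans (size_polyMleq _ _) _.
  have s2 : (size ((a 0 i)%:P + b 0 i *: 'X)%R <= 2)%N.
    apply: leq_trans (size_polyD _ _) _; rewrite geq_max (leq_trans (size_polyC_leq1 _)) //=.
    by apply: leq_trans (size_scale_leq _ _) _; rewrite size_polyX.
  by rewrite -subn1 leq_subLR (leq_trans (leq_add s2 IH)).
Qed.

Lemma mpeval_line_deg p d : poly_deg_le n d p -> line_poly_deg d (mpeval p).
Proof.
rewrite /mpeval; elim: p => [|tm p IH] H a b.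
  by exists 0; rewrite ?size_poly0 // => t; rewrite big_nil horner0.
have [q sq Hq] := IH (fun tm' h => H tm' (or_intror h)) a b.
have [r sr Hr] := monomial_line tm.2 a b.
have dr : (\sum_(i < n) tm.2 i <= d)%N by rewrite -nsumE; apply/ssrnat.leP; apply: (H tm); left.
exists (c2k tm.1 *: r + q) => [|t]; last by rewrite big_cons hornerD hornerZ Hq Hr.
apply: leq_trans (size_polyD _ _) _; rewrite geq_max sq andbT.
by apply: leq_trans (size_scale_leq _ _) _; apply: leq_trans sr _.
Qed.

Lemma mpeval_line p : line_poly (mpeval p).
Proof.
suff [d Hd] : exists d, poly_deg_le n d p.
  by move=> a b; have [q _ Hq] := mpeval_line_deg Hd a b; exists q.
elim: p => [|tm p [d Hd]]; first by exists 0%N.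
exists (nsum n tm.2 + d)%N => tm' [<-|/Hd]; first by apply/ssrnat.leP; rewrite leq_addr.
by move/ssrnat.leP => h; apply/ssrnat.leP; apply: leq_trans h _; rewrite leq_addl.
Qed.
End Row.

Lemma toK_D4_fun m Z : toK (D4_fun m Z) =
  1 - \sum_(j < m) c2k (Z j) * (c2k (Z j))^*
    + (2^-1 * \sum_(j < m) c2k (Z j) ^+ 2) * (2^-1 * \sum_(j < m) c2k (Z j) ^+ 2)^*.
Proof.
have -> : D4_fun m Z = 1 - norm2 m Z + 4^-1 * Cnorm2 (bilin m Z).
  rewrite /D4_fun; congr (Rplus _ (Rmult (Rinv _) _)).
  by rewrite -[RHS]INRE INR_IZR_INZ.
rewrite rmorphD rmorphB rmorph1 rmorphM fmorphV rmorph_nat /=.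
congr (_ - _ + _).
  by rewrite /norm2 toK_Rsum; apply: eq_bigr => i _; rewrite toK_Cnorm2.
rewrite toK_Cnorm2 /bilin c2k_Csum [(2^-1 * _)^*]rmorphM fmorphV /= conjC_nat.
under eq_bigr do rewrite c2kM -expr2.
rewrite mulrACA; congr (_ * _); rewrite -invfM -natrM //.
Qed.

Section DiscOpen.
Local Open Scope R_scope.
Lemma disc_open (a b r : RR) : (a * a + b * b) * r < 1 -> 0 <= r ->
  exists2 d, 0 < d & forall t, Rabs t < d ->
    ((a + t) * (a + t) + b * b) * r < 1 /\ (a * a + (b + t) * (b + t)) * r < 1.
Proof.
move=> h r0; pose B := Rabs a + Rabs b; pose G := 1 - (a * a + b * b) * r.
have a0 := Rabs_pos a; have b0 := Rabs_pos b.
have D0 : 0 < r * (2 * B + 1) + 1.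
  have : 0 <= r * (2 * B + 1) by apply: Rmult_le_pos => //; rewrite /B; lra.
  lra.
have G0 : 0 < G by rewrite /G; lra.
(* For |t| < 1, moving a or b by t raises the sum of squares by at most (2 B + 1) |t|, and G is the
   room left. The final 1 keeps the denominator positive when r = 0. *)
exists (Rmin 1 (G / (r * (2 * B + 1) + 1))).
  by apply: Rmin_pos; [lra | apply: Rdiv_lt_0_compat].
move=> t ht; have t1 := Rlt_le_trans _ _ _ ht (Rmin_l _ _).
have t2 := Rlt_le_trans _ _ _ ht (Rmin_r _ _).
have t0 := Rabs_pos t.
have tG : Rabs t * (r * (2 * B + 1) + 1) < G.
  have := Rmult_lt_compat_r _ _ _ D0 t2.
  by rewrite /Rdiv Rmult_assoc Rinv_l ?Rmult_1_r; lra.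
have tt : t * t <= Rabs t.
  have -> : t * t = Rabs t * Rabs t by rewrite -Rabs_mult Rabs_pos_eq //; apply: Rle_0_sqr.
  rewrite -{3}[Rabs t]Rmult_1_r; apply: Rmult_le_compat_l; lra.
have key c : Rabs c <= B -> r * (2 * c * t + t * t) < G.
  move=> cB; apply: Rle_lt_trans tG.
  have ct : c * t <= B * Rabs t.
    apply: Rle_trans (Rle_abs _) _; rewrite Rabs_mult; apply: Rmult_le_compat_r => //.
  have : r * (2 * c * t + t * t) <= r * (2 * (B * Rabs t) + Rabs t).
    by apply: Rmult_le_compat_l => //; lra.
  lra.
have := key a; have := key b; rewrite /B /G => hb ha.
split; [have := ha ltac:(lra) | have := hb ltac:(lra)]; lra.
Qed.
End DiscOpen.

Section NormIdentity.
Variables (n m : nat) (F : cvec -> cvec) (P : nat -> cpoly) (Rp : cpoly) (lam0 : RR).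
Hypothesis m0 : (0 < m)%N.
Hypothesis n0 : (0 < n)%N.
Hypothesis FR : forall z, in_ball n z -> poly_eval n Rp z <> Defs.C0 /\
  forall j, (j < m)%coq_nat -> F z j = Cdiv (poly_eval n (P j) z) (poly_eval n Rp z).
Hypothesis FD : forall z, in_ball n z -> in_D4 m (F z).
Hypothesis F0 : forall j, (j < m)%coq_nat -> F czero j = Defs.C0.
Hypothesis lam0_gt0 : Rlt 0 lam0.
Hypothesis iso : forall z v : cvec, in_ball n z -> exists l : RR,
  levi (logK_ball n) z v l /\ levi (fun w => logK_D4 m (F w)) z v (Rmult lam0 l).

Notation V := 'rV[K]_n.
Let f (j : 'I_m) (x : V) := mpeval (P j) x / mpeval Rp x.

Lemma denominator_neq0 (x : V) : hnorm2 x < 1 -> mpeval Rp x != 0.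
Proof.
rewrite -(cvec_ofK x) => /in_ballP /FR [H _]; apply/eqP; rewrite -c2k_poly_eval => h.
by apply: H; apply: c2k_inj.
Qed.

Lemma c2k_F z (j : 'I_m) : in_ball n z -> c2k (F z j) = f j (row_of n z).
Proof.
move=> /FR [_ ->]; last exact/ssrnat.ltP.
by rewrite c2k_div !c2k_poly_eval.
Qed.

Lemma numerator_at0 (j : 'I_m) : mpeval (P j) (0 : V) = 0.
Proof.
have b0 : in_ball n czero by apply/in_ballP; rewrite row_of_zero hnorm2_0.
have := c2k_F j b0; rewrite F0; last exact/ssrnat.ltP.
rewrite row_of_zero => /esym/eqP; rewrite mulf_eq0 invr_eq0.
have /negPf -> : mpeval Rp (0 : V) != 0 by apply: denominator_neq0; rewrite hnorm2_0.
by rewrite orbF => /eqP.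
Qed.

(** The kernel exponents n + 1 and m convert the metric constant into the factor between the
    Hessians of log(1 - |z|^2) and of the logarithm of [D4_fun] along F. *)
Let lam : K := toK lam0 * n.+1%:R / m%:R.

Section Disc.
Variable x : V.
Hypotheses (bx : hnorm2 x < 1) (x0 : x != 0).
Variables (p : 'I_m -> {poly K}) (r : {poly K}).
Hypothesis pE : forall (j : 'I_m) t, mpeval (P j) (0 + t *: x) = (p j).[t].
Hypothesis rE : forall t, mpeval Rp (0 + t *: x) = r.[t].

Let rho := hnorm2 x.
Let rho0 : rho != 0.
Proof. by apply: contra x0 => /eqP h; rewrite (hnorm2_eq0 h). Qed.

Let cj (q : {poly K}) := map_poly Num.conj q.
Let hh := 2^-1 *: \sum_j p j ^+ 2.
(** Polarizes a(t) conj(b(t)): with the coefficients of b conjugated, the second factor is a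
    polynomial in s with the right value at s = conj(t). *)
Let sesq (a b : {poly K}) : {poly {poly K}} := a^:P * (cj b)%:P.
Let S := sesq (r * r) (r * r).
Let N := S - \sum_j sesq (r * p j) (r * p j) + sesq hh hh.
Let M := ball_poly rho.

Let sesqE a b t s : (sesq a b).[t%:P].[s^*] = a.[t] * (b.[s])^*.
Proof. by rewrite /sesq !hornerM horner_map hornerC /= hornerC horner_map. Qed.

Let in_disc (t : K) := t * t^* * rho < 1.

Let disc_ball t : in_disc t -> hnorm2 (0 + t *: x) < 1.
Proof. by rewrite add0r hnorm2Z. Qed.

Let r_neq0 t : in_disc t -> r.[t] != 0.
Proof. by move=> /disc_ball /denominator_neq0; rewrite rE. Qed.

Let S_val t : S.[t%:P].[t^*] = r.[t] * r.[t] * (r.[t] * r.[t])^*.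
Proof. by rewrite sesqE hornerM. Qed.

Let S_gt0 t : in_disc t -> 0 < S.[t%:P].[t^*].
Proof. by move=> /r_neq0 h; rewrite S_val mul_conjC_gt0 mulf_neq0. Qed.

Let f_val j t : in_disc t -> f j (0 + t *: x) = (p j).[t] / r.[t].
Proof. by move=> _; rewrite /f pE rE. Qed.

Let N_val0 t : in_disc t -> N.[t%:P].[t^*] = S.[t%:P].[t^*] *
  (1 - \sum_j f j (0 + t *: x) * (f j (0 + t *: x))^*
   + (2^-1 * \sum_j f j (0 + t *: x) ^+ 2) * (2^-1 * \sum_j f j (0 + t *: x) ^+ 2)^*).
Proof.
move=> dt; have rt := r_neq0 dt.
rewrite /N !hornerD !hornerN !horner_sum S_val [(sesq hh hh).[_].[_]]sesqE mulrDr mulrBr mulr1; congr (_ - _ + _).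
  rewrite mulr_sumr; apply: eq_bigr => j _.
  by rewrite sesqE !hornerM f_val // hermitian_quotient.
have -> : 2^-1 * \sum_j f j (0 + t *: x) ^+ 2 = hh.[t] / (r.[t] * r.[t]).
  rewrite /hh hornerZ horner_sum -mulrA mulr_suml; congr (_ * _); apply: eq_bigr => j _.
  by rewrite f_val // horner_exp; field.
by rewrite -hermitian_quotient2.
Qed.

Let N_val t w : in_disc t -> row_of n w = t *: x ->
  N.[t%:P].[t^*] = S.[t%:P].[t^*] * toK (D4_fun m (F w)).
Proof.
move=> dt rw; have bw : in_ball n w by apply/in_ballP; rewrite rw -[t *: x]add0r disc_ball.
rewrite N_val0 // toK_D4_fun add0r -rw; congr (_ * (1 - _ + _ * (_ * _)^*)).
- by apply: eq_bigr => j _; rewrite c2k_F.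
- by congr (_ * _); apply: eq_bigr => j _; rewrite c2k_F.
- by apply: eq_bigr => j _; rewrite c2k_F.
Qed.

Let M_val t w : row_of n w = t *: x -> M.[t%:P].[t^*] = toK (1 - norm2 n w).
Proof.
move=> rw; rewrite rmorphB rmorph1 /= toK_norm2 rw hnorm2Z /M /ball_poly -/rho !hornerE.
by ring.
Qed.

Let D4_gt0 w t : in_disc t -> row_of n w = t *: x -> Rlt 0 (D4_fun m (F w)).
Proof.
move=> dt rw; have bw : in_ball n w by apply/in_ballP; rewrite rw -[t *: x]add0r disc_ball.
by have [_] := FD bw.
Qed.

(** The zero coefficient in the formula for the ball puts both logarithms in the two-term shape of
    [second_deriv0_lin]; for the target, the logarithm of N = S [D4_fun] (F) is split. *)
Let point t w : in_disc t -> row_of n w = t *: x ->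
  [/\ 0 < N.[t%:P].[t^*], 0 < M.[t%:P].[t^*],
    logK_ball n w = Rplus (Rmult (- INR (n + 1)) (ln (complex.Re M.[t%:P].[t^*])))
                     (Rmult 0 (ln (complex.Re M.[t%:P].[t^*]))) &
    logK_D4 m (F w) = Rplus (Rmult (- INR m) (ln (complex.Re N.[t%:P].[t^*])))
                     (Rmult (INR m) (ln (complex.Re S.[t%:P].[t^*])))].
Proof.
move=> dt rw; have D0 := D4_gt0 dt rw.
have D0K : 0 < toK (D4_fun m (F w)) by rewrite ltcR; apply/RltP.
have bw : in_ball n w by apply/in_ballP; rewrite rw -[t *: x]add0r disc_ball.
have [SE Spos] := pos_toK (S_gt0 dt).
split.
- by rewrite (N_val dt rw) mulr_gt0 // S_gt0.
- by rewrite (M_val rw) ltcR subr_gt0; apply/RltP.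
- rewrite (M_val rw) /logK_ball /=.
  by change (1 - norm2 n w) with (Rminus 1 (norm2 n w)); rewrite Rmult_0_l Rplus_0_r.
- rewrite (N_val dt rw) {1}SE -rmorphM /=.
  set sv := complex.Re _ in SE Spos *.
  have -> : ln (sv * D4_fun m (F w)) = Rplus (ln sv) (ln (D4_fun m (F w))).
    exact: ln_mult.
  by rewrite /logK_D4; lra.
Qed.

Let disc_radius t : in_disc t -> exists2 d, Rlt 0 d & forall s, Rlt (Rabs s) d ->
  in_disc (t + toK s) /\ in_disc (t + 'i * toK s).
Proof.
have rhoE : rho = toK (complex.Re rho) by rewrite RRe_real // ger0_real // hnorm2_ge0.
have r0 : Rle 0 (complex.Re rho).
  by apply/RleP; rewrite -ler0c -rhoE hnorm2_ge0.
have inE (a b : RR) : in_disc (Complex a b) <->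
    Rlt (Rmult (Rplus (Rmult a a) (Rmult b b)) (complex.Re rho)) 1.
  have -> : in_disc (Complex a b) = (toK ((a * a + b * b) * complex.Re rho) < toK 1).
    rewrite /in_disc rmorph1 {1}rhoE rmorphM; congr (_ * _ < _).
    by rewrite -[Complex a b]/(c2k (a, b)) -toK_Cnorm2.
  by rewrite ltcR; split => /RltP.
case: t => a b /inE h; have [d d0 Hd] := disc_open h r0.
exists d => // s /Hd [h1 h2]; split.
  suff -> : Complex a b + toK s = Complex (a + s) b by apply/inE.
  by apply/eqP; rewrite eq_complex /= addr0 !eqxx.
suff -> : Complex a b + 'i * toK s = Complex a (b + s) by apply/inE.
by rewrite -complexiE; apply/eqP; rewrite eq_complex /= !mulr0 !mul0r mul1r subrr !addr0 !add0r !eqxx.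
Qed.

(** At z = t x in the direction x, the Levi forms of the isometry are matched with the values of
    [levi_ln] for M, N and S; S contributes zero, being a product a(t) b(s). *)
Let pde t : in_disc t ->
  (M ^+ 2 * log_hessian N + (rho * lam)%:P%:P * N ^+ 2).[t%:P].[t^*] = 0.
Proof.
move=> dt; have [d d0 Hd] := disc_radius dt.
pose v := cvec_of x; pose z := vscale (k2c t) v.
have rz : row_of n z = t *: x by rewrite row_of_scale k2cK cvec_ofK.
have bz : in_ball n z by apply/in_ballP; rewrite rz -[t *: x]add0r disc_ball.
have r1 s : row_of n (vadd z (vscale (RtoC s) v)) = (t + toK s) *: x.
  by rewrite row_of_add rz row_of_scale cvec_ofK c2k_RtoC scalerDl.
have r2 s : row_of n (vadd z (vscale (RtoC s) (vscale Ci v))) = (t + 'i * toK s) *: x.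
  by rewrite row_of_add rz !row_of_scale cvec_ofK c2k_RtoC c2k_i scalerA mulrC scalerDl.
have p1 s hs := point (proj1 (Hd s hs)) (r1 s).
have p2 s hs := point (proj2 (Hd s hs)) (r2 s).
have [n1 [n2 [N1 N2 N3]]] : exists l1 l2, _ := @levi_ln N t d d0
  (fun s hs => let: And4 h _ _ _ := p1 s hs in h) (fun s hs => let: And4 h _ _ _ := p2 s hs in h).
have [m1 [m2 [M1 M2 M3]]] : exists l1 l2, _ := @levi_ln M t d d0
  (fun s hs => let: And4 _ h _ _ := p1 s hs in h) (fun s hs => let: And4 _ h _ _ := p2 s hs in h).
have [s1 [s2 [S1 S2 S3]]] := @levi_ln S t d d0
  (fun s hs => S_gt0 (proj1 (Hd s hs))) (fun s hs => S_gt0 (proj2 (Hd s hs))).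
have [l [[b1 [b2 [B1 [B2 El]]]] [d1 [d2 [D1 [D2 Dl]]]]]] := iso v bz.
have Eb1 := second_deriv0_unique d0
  (fun s hs => let: And4 _ _ h _ := p1 s hs in h) B1 (second_deriv0_lin _ _ M1 M1).
have Eb2 := second_deriv0_unique d0
  (fun s hs => let: And4 _ _ h _ := p2 s hs in h) B2 (second_deriv0_lin _ _ M2 M2).
have Ed1 := second_deriv0_unique d0
  (fun s hs => let: And4 _ _ _ h := p1 s hs in h) D1 (second_deriv0_lin _ _ N1 S1).
have Ed2 := second_deriv0_unique d0
  (fun s hs => let: And4 _ _ _ h := p2 s hs in h) D2 (second_deriv0_lin _ _ N2 S2).
have E : Rmult (INR m) (Rminus (Rplus n1 n2) (Rplus s1 s2)) =
    Rmult (Rmult lam0 (INR (n + 1))) (Rplus m1 m2).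
  by move: Dl; rewrite El Eb1 Eb2 Ed1 Ed2; lra.
have {}E : m%:R * (toK (Rplus n1 n2) - toK (Rplus s1 s2)) =
    toK lam0 * n.+1%:R * toK (Rplus m1 m2).
  have /(congr1 toK) := E; rewrite !INRE addn1.
  change (toK (m%:R * (Rplus n1 n2 - Rplus s1 s2)) = toK (lam0 * n.+1%:R * Rplus m1 m2) ->
    m%:R * (toK (Rplus n1 n2) - toK (Rplus s1 s2)) = toK lam0 * n.+1%:R * toK (Rplus m1 m2)).
  by rewrite !rmorphM rmorphB !rmorph_nat.
have St : S.[t%:P].[t^*] != 0 by rewrite lt0r_neq0 // S_gt0.
have Y0 : toK (Rplus s1 s2) = 0.
  move/eqP: S3; rewrite log_hessian_split !horner0 mulr0 mulf_eq0 sqrf_eq0 (negPf St) orbF.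
  by move/eqP.
have m0K : m%:R != 0 :> K by rewrite pnatr_eq0 -lt0n.
have X0 : toK (Rplus n1 n2) = lam * toK (Rplus m1 m2).
  by apply: (mulfI m0K); rewrite -[toK (Rplus n1 n2)]subr0 -Y0 E /lam; field.
rewrite horner2_combination.
rewrite log_hessian_ball_poly in M3; rewrite X0 in N3.
have four0 : (4 : K) != 0 by rewrite pnatr_eq0.
apply: (mulfI four0); rewrite mulr0.
move: M3 N3; move: (M.[_].[_]) (N.[_].[_]) ((log_hessian N).[_].[_]) => a b c M3 N3.
move: (toK (Rplus m1 m2)) M3 N3 => Z M3 N3.
have -> : 4 * (a ^+ 2 * c + rho * lam * b ^+ 2) = a ^+ 2 * (4 * c) + 4 * (rho * lam * b ^+ 2) by ring.
rewrite -N3.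
have -> : a ^+ 2 * (lam * Z * b ^+ 2) = lam * b ^+ 2 * (Z * a ^+ 2) by ring.
by rewrite M3; ring.
Qed.

Let lam_ge0 : 0 <= lam.
Proof.
rewrite /lam divr_ge0 ?ler0n // mulr_ge0 ?ler0n // ler0c.
by apply/RleP; apply: Rlt_le.
Qed.

Let in_disc_lt1 (t : K) : t * t^* < 1 -> in_disc t.
Proof.
move=> t1; apply: le_lt_trans t1; rewrite ler_piMr ?mul_conjC_ge0 //.
exact: ltW.
Qed.

(** [polarization] in dimension one, on the unit disc, passes from the pairs (t, conj t) to
    independent t and s. *)
Let pde_eq0 : M ^+ 2 * log_hessian N + (rho * lam)%:P%:P * N ^+ 2 = 0.
Proof.
have := pde; move: (M ^+ 2 * log_hessian N + (rho * lam)%:P%:P * N ^+ 2) => W HW.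
apply: bipoly_eq0 => t s.
pose Psi (z w : 'rV[K]_1) := W.[(z 0 0)%:P].[w 0 0].
suff /(_ (const_mx t) (const_mx s)) : forall z w, Psi z w = 0 by rewrite /Psi !mxE.
apply: polarization => [a b a' b'|z].
  exists (along W (a 0 0) (b 0 0) (a' 0 0) (b' 0 0)) => u.
  by rewrite horner_along /Psi !mxE ![_ * u]mulrC.
rewrite /hnorm2 /hdot big_ord1 /Psi !mxE => h.
by apply: HW; apply: in_disc_lt1.
Qed.

Let cj0 (q : {poly K}) : (cj q).[0] = (q.[0])^*.
Proof. by rewrite /cj -{1}[0](rmorph0 Num.conj) horner_map. Qed.

Let sesq0 a b : (sesq a b).[0] = a.[0] *: cj b.
Proof. by rewrite /sesq hornerM hornerC -polyC0 horner_map /= mul_polyC. Qed.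

Let swap_sesq0 a b : (swapXY (sesq a b)).[0] = (b.[0])^* *: a.
Proof.
rewrite /sesq rmorphM /= swapXY_map_polyC swapXY_polyC hornerM hornerC -polyC0.
by rewrite horner_map /= mulrC mul_polyC cj0.
Qed.

Let p0 j : (p j).[0] = 0.
Proof. by rewrite -pE scale0r addr0 numerator_at0. Qed.

Let hh0 : hh.[0] = 0.
Proof. by rewrite /hh hornerZ horner_sum big1 ?mulr0 // => j _; rewrite horner_exp p0 expr0n. Qed.

Lemma disc_identity : exists k : nat, lam = k%:R /\
  1 - \sum_j f j x * (f j x)^* + (2^-1 * \sum_j f j x ^+ 2) * (2^-1 * \sum_j f j x ^+ 2)^*
    = (1 - hnorm2 x) ^+ k.
Proof.
have d0 : in_disc 0 by apply: in_disc_lt1; rewrite mul0r.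
have rr0 : (r * r).[0] != 0 by rewrite hornerM mulf_neq0 ?r_neq0.
have cr0 : (cj (r * r)).[0] != 0.
  by rewrite cj0 conjC_eq0.
have N0 : N.[0] = (r * r).[0] *: cj (r * r).
  rewrite /N hornerD hornerD hornerN horner_sum /S !sesq0 hh0 scale0r addr0.
  by rewrite big1 ?subr0 // => j _; rewrite sesq0 hornerM p0 mulr0 scale0r.
have N0' : (swapXY N).[0] = (cj (r * r)).[0] *: (r * r).
  rewrite /N rmorphD rmorphB rmorph_sum /= hornerD hornerD hornerN horner_sum /S !swap_sesq0.
  rewrite hh0 rmorph0 scale0r addr0 big1 => [|j _].
    by rewrite subr0 cj0.
  by rewrite swap_sesq0 hornerM p0 mulr0 rmorph0 scale0r.
have [k [lamk Hk]] := liouville_disc lam_ge0 rho0 rr0 cr0 N0 N0' pde_eq0.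
exists k; split=> //.
(* Since |x| < 1, the disc of the line contains t = 1, where the identity is the one at x itself. *)
have d1 : in_disc 1 by rewrite /in_disc rmorph1 !mul1r.
have := N_val0 d1; rewrite scale1r add0r => E.
have S0 : S.[1%:P].[1^*] != 0 by rewrite lt0r_neq0 // S_gt0.
apply: (mulfI S0); rewrite -E.
have -> : N.[1%:P].[1^*] = N.[1%:P].[1] by rewrite conjC1.
rewrite Hk S_val hornerM !mulr1; congr (_ * _ * _).
by rewrite /cj -{1}[1](rmorph1 Num.conj) horner_map hornerM.
Qed.
End Disc.

(** The exponent on each line equals [lam], which does not depend on the line, so one k serves the
    whole ball; it is nonzero as the metric constant is positive. *)
Lemma norm_identity : exists2 k : nat, (0 < k)%N & forall x : V, hnorm2 x < 1 ->
  1 - \sum_j f j x * (f j x)^* + (2^-1 * \sum_j f j x ^+ 2) * (2^-1 * \sum_j f j x ^+ 2)^*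
    = (1 - hnorm2 x) ^+ k.
Proof.
have H (x : V) : hnorm2 x < 1 -> x != 0 -> exists k : nat, lam = k%:R /\
  1 - \sum_j f j x * (f j x)^* + (2^-1 * \sum_j f j x ^+ 2) * (2^-1 * \sum_j f j x ^+ 2)^*
    = (1 - hnorm2 x) ^+ k.
  move=> bx x0; have [p Hp] := fin_all_exists (fun j : 'I_m => @mpeval_line n (P j) 0 x).
  have [r Hr] := @mpeval_line n Rp 0 x.
  exact: (disc_identity bx x0 Hp Hr).
(* A nonzero point of the ball is needed to read off k; n > 0 provides one. *)
have [d d0 Hd] := small_line_in_ball (const_mx 1 : V) 0.
pose s := d / 2.
have s0 : 0 < s by rewrite divr_gt0.
have sd : 0 < s < d by rewrite s0 ltr_pdivrMr // ltr_pMr // ltr1n.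
have h2 : 0 < (2^-1 : K) < 1 by rewrite invr_gt0 ltr0n invf_lt1 ?ltr0n // ltr1n.
have := Hd s _ sd h2; rewrite !scaler0 addr0 => bx.
have x0 : s *: (const_mx 1 : V) != 0.
  apply/eqP => /rowP /(_ (Ordinal n0)); rewrite !mxE mulr1 => h.
  by rewrite h ltxx in s0.
have [k [lamk _]] := H _ bx x0.
exists k.
  rewrite lt0n -(pnatr_eq0 K) -lamk /lam !mulf_neq0 ?invr_eq0 ?pnatr_eq0 // -?lt0n //.
  by apply/eqP => -[] h; have := lam0_gt0; rewrite h => /Rlt_irrefl.
move=> x bx'; have [->|x0'] := eqVneq x 0.
  have f0 j : f j 0 = 0 by rewrite /f numerator_at0 mul0r.
  have -> : \sum_j f j 0 * (f j 0)^* = 0 by rewrite big1 // => j _; rewrite f0 mul0r.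
  have -> : \sum_j f j 0 ^+ 2 = 0 by rewrite big1 // => j _; rewrite f0 expr0n.
  by rewrite hnorm2_0 !mulr0 mul0r !subr0 addr0 expr1n.
have [k' [lamk' ->]] := H x bx' x0'.
suff -> : k' = k by [].
by apply/eqP; rewrite -(eqr_nat K) -lamk' -lamk.
Qed.
End NormIdentity.

(** * Representations by polynomial quotients *)

Section Cpoly.
Variable n : nat.
Notation V := 'rV[K]_n.
Implicit Types (p q : cpoly) (x : V).

Definition cp_const (c : K) : cpoly := [:: (k2c c, fun _ => 0%N)].
Definition cp_linear (g : 'I_n -> K) : cpoly :=
  [seq (k2c (g i), fun k : nat => nat_of_bool (k == i)) | i <- enum 'I_n].
Definition cp_mul p q : cpoly :=
  [seq (Cmul a.1 b.1, fun k : nat => (a.2 k + b.2 k)%N) | a <- p, b <- q].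

Lemma mpeval_cat p q x : mpeval (p ++ q) x = mpeval p x + mpeval q x.
Proof. by rewrite /mpeval big_cat. Qed.

Lemma mpeval_flatten (s : seq cpoly) x : mpeval (flatten s) x = \sum_(p <- s) mpeval p x.
Proof.
elim: s => [|p s IH]; first by rewrite /mpeval !big_nil.
by rewrite /= mpeval_cat IH big_cons.
Qed.

Lemma mpeval_const c x : mpeval (cp_const c) x = c.
Proof.
rewrite /mpeval big_seq1 k2cK /monomial big1 ?mulr1 // => i _; exact: expr0.
Qed.

Lemma mpeval_linear g x : mpeval (cp_linear g) x = linear_form g x.
Proof.
rewrite /mpeval /cp_linear big_map big_enum /=; apply: eq_bigr => i _.
rewrite k2cK /monomial (bigD1 i) //= eqxx expr1 big1 ?mulr1 // => k ki.
by rewrite (_ : (k == i :> nat) = false) ?expr0 //; apply/negbTE.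
Qed.

Lemma mpeval_mul p q x : mpeval (cp_mul p q) x = mpeval p x * mpeval q x.
Proof.
rewrite /mpeval /cp_mul big_allpairs_dep mulr_suml; apply: eq_bigr => a _.
rewrite mulr_sumr; apply: eq_bigr => b _ /=.
rewrite c2kM mulrACA; congr (_ * _); rewrite /monomial -big_split.
by apply: eq_bigr => i _; rewrite exprD.
Qed.

Lemma poly_deg_le_all d p : poly_deg_le n d p <-> all (fun tm => (nsum n tm.2 <= d)%N) p.
Proof.
elim: p => [|tm p [IH1 IH2]] /=; first by split=> // _ tm [].
split=> [H|/andP [h /IH2 H] tm' [<-|]]; last 2 first.
- by apply/ssrnat.leP.
- exact: (H tm').
apply/andP; split; first by apply/ssrnat.leP; apply: H; left.
by apply: IH1 => tm' h; apply: H; right.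
Qed.

Lemma poly_deg_le_weaken d d' p : (d <= d')%N -> poly_deg_le n d p -> poly_deg_le n d' p.
Proof.
move=> dd /poly_deg_le_all H; apply/poly_deg_le_all; apply: sub_all H => tm h.
exact: leq_trans h dd.
Qed.

Lemma poly_deg_le_cat d p q : poly_deg_le n d p -> poly_deg_le n d q ->
  poly_deg_le n d (p ++ q).
Proof.
by move=> /poly_deg_le_all H /poly_deg_le_all H'; apply/poly_deg_le_all; rewrite all_cat H.
Qed.

Lemma poly_deg_le_flatten d (s : seq cpoly) :
  (forall p, List.In p s -> poly_deg_le n d p) -> poly_deg_le n d (flatten s).
Proof.
elim: s => [|p s IH] H; first by apply/poly_deg_le_all.
by apply: poly_deg_le_cat; [apply: H; left | apply: IH => q h; apply: H; right].
Qed.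

Lemma poly_deg_le_const c : poly_deg_le n 0 (cp_const c).
Proof. by apply/poly_deg_le_all; rewrite /= nsumE big1. Qed.

Lemma poly_deg_le_linear g : poly_deg_le n 1 (cp_linear g).
Proof.
apply/poly_deg_le_all; rewrite all_map; apply/allP => i _ /=.
rewrite nsumE (bigD1 i) //= eqxx big1 // => k ki.
by rewrite (_ : (k == i :> nat) = false) //; apply/negbTE.
Qed.

Lemma poly_deg_le_mul d e p q : poly_deg_le n d p -> poly_deg_le n e q ->
  poly_deg_le n (d + e) (cp_mul p q).
Proof.
move=> /poly_deg_le_all H /poly_deg_le_all H'; apply/poly_deg_le_all.
rewrite /cp_mul; elim: p H => [//|a p IH] /= /andP [Ha Hp].
rewrite all_cat IH // andbT all_map; apply: sub_all H' => b Hb /=.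
by rewrite nsumE big_split /= -!nsumE leq_add.
Qed.
End Cpoly.

Section Representations.
Variables (n m : nat) (F : cvec -> cvec).

Lemma rat_repr_intro d (P : 'I_m -> cpoly) (Rp : cpoly) :
  poly_deg_le n d Rp -> (forall j, poly_deg_le n d (P j)) ->
  (forall x : 'rV[K]_n, hnorm2 x < 1 -> mpeval Rp x != 0) ->
  (forall z, in_ball n z -> forall j : 'I_m,
    c2k (F z j) = mpeval (P j) (row_of n z) / mpeval Rp (row_of n z)) ->
  rat_repr_deg_le n m d F.
Proof.
move=> HR HP R0 HF.
exists (fun j => if insub j is Some j' then P j' else [::]), Rp; split=> //; split.
  by move=> j /ssrnat.ltP jm; rewrite (insubT (fun j => j < m)%N jm); apply: HP.
move=> z bz; split.
  move=> h; have := R0 (row_of n z); rewrite -c2k_poly_eval h.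
  by move=> /(_ (proj1 (in_ballP n z) bz)) /eqP.
move=> j /ssrnat.ltP jm; rewrite (insubT (fun j => j < m)%N jm).
by apply: c2k_inj; rewrite c2k_div !c2k_poly_eval -HF.
Qed.

Lemma rat_repr_weaken d d' : (d <= d')%N -> rat_repr_deg_le n m d F -> rat_repr_deg_le n m d' F.
Proof.
move=> dd [P [Rp [HR [HP H]]]]; exists P, Rp; split; first exact: poly_deg_le_weaken dd HR.
by split=> // j jm; apply: poly_deg_le_weaken dd (HP j jm).
Qed.

Lemma rat_degree_le2 : rat_repr_deg_le n m 2 F ->
  exists2 d, rat_degree n m F d & (d <= 2)%N.
Proof.
move=> H2.
have [H0|H0] := Classical_Prop.classic (rat_repr_deg_le n m 0 F).
  by exists 0%N => //; split=> // d' _; apply/ssrnat.leP.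
have [H1|H1] := Classical_Prop.classic (rat_repr_deg_le n m 1 F).
  exists 1%N => //; split=> // -[|d'] // _; exact/ssrnat.leP.
by exists 2%N => //; split=> // -[|[|d']] // _; apply/ssrnat.leP.
Qed.

Definition linear_on_ball := exists g : 'I_m -> 'I_n -> K,
  forall z, in_ball n z -> forall j : 'I_m, c2k (F z j) = linear_form (g j) (row_of n z).

Lemma linear_on_ball_is_linear : linear_on_ball -> is_linear_map n m F.
Proof.
move=> [g Hg].
exists (fun j i => match insub j, insub i with Some j', Some i' => k2c (g j' i') | _, _ => C0 end).
move=> z bz j /ssrnat.ltP jm; apply: c2k_inj.
rewrite (Hg z bz (Ordinal jm)) c2k_Csum; apply: eq_bigr => i _.
by rewrite c2kM (insubT (fun j => j < m)%N jm) valK k2cK mxE.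
Qed.

Lemma linear_on_ball_repr : linear_on_ball -> rat_repr_deg_le n m 1 F.
Proof.
move=> [g Hg]; apply: (@rat_repr_intro _ (fun j => cp_linear (g j)) (cp_const 1)).
- exact: (@poly_deg_le_weaken n 0 1 _ isT (@poly_deg_le_const n 1)).
- by move=> j; apply: poly_deg_le_linear.
- by move=> x _; rewrite mpeval_const oner_neq0.
- by move=> z bz j; rewrite mpeval_const mpeval_linear divr1 Hg.
Qed.
End Representations.

(** The implication in the second alternative excludes a degree below 2 for a map that is not
    linear. *)
Lemma linear_or_degree2 (n m : nat) (F : cvec -> cvec) : (1 < n)%N -> (0 < m)%N ->
  (forall z, in_ball n z -> in_D4 m (F z)) -> is_rational_map n m F -> holo_isometry n m F ->
  (forall j, (j < m)%coq_nat -> F czero j = Defs.C0) ->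
  linear_on_ball n m F \/
  (rat_repr_deg_le n m 2 F /\ (rat_repr_deg_le n m 1 F -> linear_on_ball n m F)).
Proof.
move=> n1 m0 FD [d [P [Rp [_ [_ FR]]]]] [lam [lam0 iso]] F0.
have n0 : (0 < n)%N by apply: leq_trans n1.
have [k k0 Hk] := norm_identity m0 n0 FR FD F0 lam0 iso.
pose i0 : 'I_n := Ordinal n0; pose i1 : 'I_n := Ordinal n1.
have FE z (bz : in_ball n z) (j : 'I_m) := c2k_F FR j bz.
have dichotomy := @linear_or_quadratic K n m (fun j => mpeval (P j)) (mpeval Rp) i0 i1 k
  (fun j => @mpeval_line n (P j)) (@mpeval_line n Rp) isT
  (fun x bx => denominator_neq0 FR bx) (fun j => numerator_at0 FR F0 j) k0 Hk.
case: dichotomy => [[g Hg]|[al [be [B1 FQ Fdeg]]]].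
  by left; exists g => z bz j; rewrite FE // Hg //; apply/in_ballP.
right; split; last first.
  move=> [P' [R' [dR [dP HF]]]].
  have R'0 (x : 'rV[K]_n) : hnorm2 x < 1 -> mpeval R' x != 0.
    rewrite -(cvec_ofK x) => /in_ballP /HF [H _]; apply/eqP; rewrite -c2k_poly_eval => h.
    by apply: H; apply: c2k_inj.
  exists be => z bz j; rewrite FE //.
  have bx := proj1 (in_ballP n z) bz.
  apply: (Fdeg (fun j : 'I_m => mpeval (P' j)) (mpeval R')) => //.
  - by move=> i; apply: mpeval_line_deg; apply: dP; apply/ssrnat.ltP.
  - exact: mpeval_line_deg.
  - move=> x; rewrite -(cvec_ofK x) => /in_ballP by' i; rewrite -FE //.
    have [_ ->] := HF _ by'; last exact/ssrnat.ltP.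
    by rewrite c2k_div !c2k_poly_eval.
(* [R'] encodes 2 (1 - B), so that F_j = (al_j Q + be_j R') / R' has numerator of degree at most
   2. *)
pose b i := - (2 * \sum_j al j * be j i).
pose R' := cp_const 2 ++ cp_linear b.
have R'E (x : 'rV[K]_n) : mpeval R' x = 2 * (1 - \sum_j al j * linear_form (be j) x).
  rewrite mpeval_cat mpeval_const mpeval_linear mulrBr mulr1; congr (_ + _).
  rewrite /linear_form mulr_sumr -sumrN.
  under [in RHS]eq_bigr do rewrite !mulr_sumr -sumrN.
  rewrite exchange_big /=; apply: eq_bigr => i _.
  by rewrite /b mulNr mulr_sumr mulr_suml -sumrN; apply: eq_bigr => j _; ring.
pose Qp := flatten [seq cp_mul (cp_linear (be j)) (cp_linear (be j)) | j <- enum 'I_m].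
have QE (x : 'rV[K]_n) : mpeval Qp x = \sum_j linear_form (be j) x ^+ 2.
  rewrite mpeval_flatten big_map big_enum /=; apply: eq_bigr => j _.
  by rewrite mpeval_mul mpeval_linear.
have dlin (g : 'I_n -> K) := @poly_deg_le_linear n g.
have dR : poly_deg_le n 1 R'.
  by apply: poly_deg_le_cat => //; exact: (@poly_deg_le_weaken n 0 1 _ isT (@poly_deg_le_const n 2)).
have R'0 (x : 'rV[K]_n) : hnorm2 x < 1 -> mpeval R' x != 0.
  by move=> bx; rewrite R'E mulf_neq0 ?pnatr_eq0 // subr_eq0 eq_sym B1.
apply: (@rat_repr_intro n m F 2
  (fun j => cp_mul (cp_const (al j)) Qp ++ cp_mul (cp_linear (be j)) R') R') => //.
- exact: (@poly_deg_le_weaken n 1 2 _ isT dR).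
- move=> j; apply: poly_deg_le_cat; last exact: (poly_deg_le_mul (d := 1) (e := 1)).
  apply: (poly_deg_le_mul (d := 0) (e := 2)); first exact: poly_deg_le_const.
  apply: poly_deg_le_flatten => q /List.in_map_iff [i [<- _]].
  exact: (poly_deg_le_mul (d := 1) (e := 1)).
- move=> z bz j; have bx := proj1 (in_ballP n z) bz.
  rewrite FE // FQ // mpeval_cat !mpeval_mul mpeval_const mpeval_linear QE -R'E.
  by have := R'0 _ bx => h; field.
Qed.

Lemma degree_dichotomy (n m : nat) (F : cvec -> cvec) :
  (3 <= n + 1)%coq_nat -> (n + 1 <= m)%coq_nat ->
  (forall z, in_ball n z -> in_D4 m (F z)) ->
  is_rational_map n m F ->
  holo_isometry n m F ->
  (forall j, (j < m)%coq_nat -> F czero j = Defs.C0) ->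
  (exists d, rat_degree n m F d /\ (d <= 2)%coq_nat) /\
  (is_linear_map n m F \/ rat_degree n m F 2).
Proof.
rewrite addn1 => /ssrnat.leP n2 /ssrnat.leP nm FD Frat iso F0.
have m0 : (0 < m)%N by apply: leq_ltn_trans nm.
have H := linear_or_degree2 n2 m0 FD Frat iso F0.
have [R2 lin1] : rat_repr_deg_le n m 2 F /\ (rat_repr_deg_le n m 1 F -> linear_on_ball n m F).
  by case: H => [L|//]; split=> //; apply: (@rat_repr_weaken n m F 1 2 isT); apply: linear_on_ball_repr.
have [d dF d2] := rat_degree_le2 R2.
split; first by exists d; split=> //; apply/ssrnat.leP.
have [e|d1] := eqVneq d 2%N; first by right; rewrite -e.
left; apply: linear_on_ball_is_linear; apply: lin1.
apply: (@rat_repr_weaken n m F d 1) (proj1 dF).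
by rewrite -ltnS ltn_neqAle d1.
Qed.

End BallToType4.

Theorem mainTheorem8 (n m : nat) (F : cvec -> cvec) :
  (3 <= n + 1)%nat -> (n + 1 <= m)%nat ->
  (forall z, in_ball n z -> in_D4 m (F z)) ->
  is_rational_map n m F ->
  holo_isometry n m F ->
  (forall j, (j < m)%nat -> F czero j = C0) ->
  (exists d, rat_degree n m F d /\ (d <= 2)%nat) /\
  (is_linear_map n m F \/ rat_degree n m F 2).
Proof.
exact (@BallToType4.degree_dichotomy n m F).
Qed.
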